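(* Let $V(n)$ be the total number of random walk steps (microsteps) required for the first $n$ particles of competitive erosion on $\mathbb{Z}$, started from the empty configuration, to settle, i.e. $V(n)=\sum_{i=1}^n\tau^i$. Then, as $n\to\infty$, $\frac{V(n)}{n}\to\alpha$ in probability, where $$\alpha=\left(\frac12-\sum_{j=1}^\infty\frac{1}{j(j+1)^2(j+2)}\right)^{-1}.$$
   Context: Competitive erosion on $\mathbb{Z}$. A configuration assigns to each site of $\mathbb{Z}\setminus\{0\}$ a value in $\{0,\mathrm{R},\mathrm{B}\}$ (uncolored, red, blue). Let $X(0)\equiv 0$, and let $(Y^n)_{n\ge1}$ be independent simple symmetric random walks on $\mathbb{Z}$ with $Y^n(0)=0$. Given $X(n-1)$: if $n$ is odd (blue particle) let $\tau^n=\inf\{i\ge 1: Y^n(i)\neq 0,\ X(n-1)(Y^n(i))\in\{0,\mathrm{R}\}\}$ and let $X(n)$ agree with $X(n-1)$ except that $X(n)(Y^n(\tau^n))=\mathrm{B}$. If $n$ is even (red particle) let $\tau^n=\inf\{i\ge 1: Y^n(i)\neq 0,\ X(n-1)(Y^n(i))\in\{0,\mathrm{B}\}\}$ and let $X(n)$ agree with $X(n-1)$ except that $X(n)(Y^n(\tau^n))=\mathrm{R}$. *)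

(* Defs.v *)
From HB Require Import structures.
From mathcomp Require Import all_boot all_order all_algebra finmap.
From mathcomp Require Import all_classical all_reals all_analysis.

Set Implicit Arguments.
Unset Strict Implicit.
Unset Printing Implicit Defensive.

Import Order.TTheory GRing.Theory Num.Theory.
Import numFieldNormedType.Exports.

Local Open Scope classical_set_scope.
Local Open Scope ring_scope.

Section Probability.
Context d (T : measurableType d) (R : realType) (P : probability T R).

Definition mutually_independent (I : choiceType) (D : set I)
    (F : I -> set (set T)) : Prop :=
  forall J : {fset I}, [set` J] `<=` D ->
  forall E : I -> set T, (forall i, i \in J -> F i (E i)) ->
  P (\bigcap_(i in [set` J]) E i) = (\prod_(i <- J) P (E i))%E.

(* [int] is understood with its discrete sigma-algebra. *)
Definition sigma_int (X : T -> int) : set (set T) :=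
  [set X @^-1` B | B in [set: set int]].

Definition sigma_process (S : nat -> T -> int) : set (set T) :=
  <<s \bigcup_i sigma_int (S i) >>.

Definition simple_symmetric_random_walk (S : nat -> T -> int) : Prop :=
  let step i w := S i.+1 w - S i w in
  [/\ forall i, sigma_int (S i) `<=` measurable,
      forall w, S 0%N w = 0,
      mutually_independent [set: nat] (fun i => sigma_int (step i)) &
      forall i, P [set w | step i w = 1] = (2^-1)%:E /\
                P [set w | step i w = -1] = (2^-1)%:E].

Definition cvg_in_probability (Z : nat -> T -> \bar R) (a : R) : Prop :=
  forall e : R, 0 < e ->
    P [set w | (e%:E < `|Z n w - a%:E|)%E] @[n --> \oo] --> 0%E.

End Probability.

Inductive color := Uncolored | Red | Blue.

Definition site := {z : int | z != 0}.

Definition config := site -> color.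

Definition particle_color (n : nat) : color := if odd n then Blue else Red.

Definition opponent_color (n : nat) : color := if odd n then Red else Blue.

(* Everything below is deterministic given the trajectories: [Y n i] is the
   position of the [n]-th particle after [i] steps, for [n >= 1]. *)
Section Erosion.
Variable R : realType.

(* The infimum of the empty set is [+oo]. *)
Definition settling_time (n : nat) (X : config) (y : nat -> int) : \bar R :=
  ereal_inf [set (i%:R)%:E | i in [set i : nat | (1 <= i)%N /\
    exists2 s : site, y i = val s & X s = Uncolored \/ X s = opponent_color n]].

(* If the settling time is infinite, the configuration is left unchanged. *)
Definition settle (n : nat) (X : config) (y : nat -> int) : config :=
  fun s => if `[< exists2 i : nat,
                    settling_time n X y = (i%:R)%:E & y i = val s >]
           then particle_color n else X s.

Fixpoint erosion (Y : nat -> nat -> int) (n : nat) : config :=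
  if n is m.+1 then settle n (erosion Y m) (Y n) else fun=> Uncolored.

Definition tau (Y : nat -> nat -> int) (n : nat) : \bar R :=
  settling_time n (erosion Y n.-1) (Y n).

Definition total_steps (Y : nat -> nat -> int) (n : nat) : \bar R :=
  (\sum_(1 <= i < n.+1) tau Y i)%E.

Definition alpha : R :=
  (1 / 2 - limn (fun n : nat => \sum_(1 <= j < n)
     (1 / (j%:R * (j%:R + 1) ^+ 2 * (j%:R + 2)) : R)))^-1.

End Erosion.

(* Main.v *)
Require Import Defs.
From HB Require Import structures.
From mathcomp Require Import all_boot all_order all_algebra finmap.
From mathcomp Require Import all_classical all_reals all_analysis.
From mathcomp Require Import measurable_realfun zify ring lra.

Set Implicit Arguments.
Unset Strict Implicit.
Unset Printing Implicit Defensive.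

Import Order.TTheory GRing.Theory Num.Theory.
Import numFieldNormedType.Exports.

Local Open Scope classical_set_scope.
Local Open Scope ring_scope.

(** When a particle starts, the particle before it has just settled on one side
    of the origin, the near side. The near site at distance 1 is therefore a
    target; on the other, far, side there is a run of [k] sites of the
    particle's own colour followed by a target. The particle performs a walk on
    an interval of length [k + 2] and lands at the far target with probability
    [1 / (k + 2)]; it makes [k + 1] steps on average.

    Count on the right red minus blue arrivals, on the left blue minus red ones,
    and let [u] be the sum of the two counts. Colours alternate, so that [u]
    moves by one unit with each particle, and the two counts are the integer
    parts of [u / 2] rounded down and up: both sides mirror the same path. The
    path goes on in the same direction when the particle lands on the far side
    and turns back otherwise. The colours are determined by the nested intervals
    that the path has swept: its range, the part of the range swept since the
    last visit to one of its ends, and so on. The stack lists the lengths of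
    these intervals, innermost first. If [y] is the innermost length then
    [k = y / 2], rounded down; turning back puts a new interval of length 1 on
    the stack, going on increases [y], and an interval that reaches the length
    of the enclosing one disappears together with it. Hence the stack is a
    Markov chain (lemmas [settle_paint] and [chain_mean]).

    An interval born inside one of length [y] grows to length [y] with
    probability [1 / harm y], where [harm y] is of order [y ^ 2 / 4]. This makes
    the Poisson equation for any cost depending on [y] explicitly solvable
    ([mean_step_pot]). For the cost [k + 1 - alpha] the solution is bounded by
    the cube of the length [L] of the whole range ([cubic_bound]); the constant
    [alpha] is the ratio, for long intervals, of the number of steps to the
    number of particles spent inside. For the cost [k + 1] the solution is a sum
    of squares that dominates [L ^ 4] ([extent4_le_quartic]). Comparing the two,
    the mean of [L ^ 4] after [n] particles is at most the mean number of steps,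
    which is [alpha * n] up to the mean of [L ^ 3]; so [L ^ 4] has mean
    [O(n)] and [L ^ 3] has mean [o(n)] ([cube_growth]).

    Finally [V n - alpha * n + cubic_pot] is a martingale whose increments have
    second moment [O(L ^ 3)] ([deviation_step]), by the first two moments of the
    exit time in the gambler's ruin problem. Its variance is [o(n ^ 2)], the
    potential is [o(n)] in mean, and convergence in probability follows from
    the inequalities of Chebyshev and Markov. *)

(** * Stacks and the colours they encode *)

(** Distance from the origin to the far target when the innermost interval has
    length [y]. *)
Definition gap (y : nat) : nat := (y./2).+1.

(** Reciprocal of the probability that an interval born inside one of length [y]
    grows to length [y]. *)
Definition harm (y : nat) : nat := (uphalf y * gap y)%N.

(** An interval as long as the enclosing one disappears together with it: the path
    is then at an end of the interval two levels up. The outermost interval has no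
    enclosing one and stays. *)
Definition normalize (s : seq nat) : seq nat :=
  if s is y :: x :: t then
    if (x <= y)%N then (if t is [::] then [:: y] else t) else s
  else s.

Definition advance (s : seq nat) : seq nat :=
  if s is y :: t then normalize (y.+1 :: t) else s.

Definition retreat (s : seq nat) : seq nat := normalize (1%N :: s).

(** The one-element stack [0] describes the empty configuration. *)
Definition stack (s : seq nat) : bool :=
  (s == [:: 0%N]) || (path ltn 0%N s && (s != [::])).

Definition top (s : seq nat) : nat := head 0%N s.

Definition extent (s : seq nat) : nat := last 0%N s.

(** Number of sites on the near ([true]) or far side among the sites coded by an
    interval of length [y] that ends with an edge of the near side. *)
Definition run_end (b : bool) (y : nat) : nat := if b then uphalf y else y./2.

(** Colours seen from the origin on one side, [Some true] being the colour of the
    innermost run and [None] an uncoloured site. Successive intervals share an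
    endpoint; the edge at that endpoint belongs to the other side when the length
    is even, hence the exchange of [b]. *)
Fixpoint shade (b : bool) (s : seq nat) (x : nat) : option bool :=
  if s is y :: t then
    if (x <= run_end b y)%N then Some true
    else omap negb (shade (b (+) ~~ odd y) t x)
  else None.

Lemma harmS y : harm y.+1 = (harm y + gap y)%N.
Proof. rewrite /harm /gap /= uphalfE; lia. Qed.

Lemma harm_le x y : (x <= y)%N -> (harm x <= harm y)%N.
Proof.
move=> /subnK <-; elim: (y - x)%N => [//|k IH].
by rewrite addSn harmS (leq_trans IH) ?leq_addr.
Qed.

Lemma sqr_le_harm y : (y.+1 ^ 2 <= (4 * harm y).+1)%N.
Proof.
have := odd_double_half y; rewrite /harm /gap uphalf_half.
by case: (odd y) => /= <-; nia.
Qed.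

Lemma harm_le_sqr y : (harm y <= y.+1 ^ 2)%N.
Proof.
have := odd_double_half y; rewrite /harm /gap uphalf_half.
by case: (odd y) => /= <-; nia.
Qed.

Lemma gap_le y : (gap y <= y.+1)%N.
Proof. by rewrite /gap ltnS -{2}(odd_double_half y) -addnn addnA leq_addl. Qed.

Lemma path_ltn_last y t : path ltn y t -> (y <= last y t)%N.
Proof.
elim: t y => //= x t IH y /andP[yx /IH]; exact/leq_trans/ltnW.
Qed.

Lemma stack_top_le s : stack s -> (top s <= extent s)%N.
Proof.
case: s => [|y t] //= /orP[/eqP[-> ->]//|/andP[/andP[_ /path_ltn_last]]] //.
Qed.

Lemma stack_cons2 y x t :
  stack [:: y, x & t] = [&& (0 < y)%N, (y < x)%N & path ltn x t].
Proof. by rewrite /stack eqseq_cons andbF /= andbT. Qed.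

Lemma stack_consW x t : path ltn x t -> (0 < x)%N -> stack (x :: t).
Proof. by move=> xt x0; rewrite /stack /= xt x0 orbT. Qed.

Lemma stack_behead y x t : stack [:: y, x & t] -> stack (x :: t).
Proof. by rewrite stack_cons2 => /and3P[y0 yx xt]; apply: stack_consW => //; exact: ltn_trans yx. Qed.

Lemma stack_normalize y x t : (0 < y <= x)%N -> path ltn x t ->
  stack (normalize [:: y, x & t]).
Proof.
move=> /andP[y0 yx] xt /=; case: ifP => [xy|/negbT]; last first.
  by rewrite -ltnNge => {}yx; rewrite /stack /= y0 yx xt orbT.
case: t xt => [|z t] /= xt; first by rewrite /stack /= y0 orbT.
case/andP: xt => xz zt; rewrite /stack /= zt (leq_trans y0) ?orbT//.
exact: leq_trans yx (ltnW xz).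
Qed.

Lemma stack_advance s : stack s -> stack (advance s).
Proof.
case: s => [|y [|x t]] //.
by rewrite stack_cons2 => /and3P[y0 yx xt]; apply: stack_normalize.
Qed.

Lemma stack_retreat s : stack s -> stack (retreat s).
Proof.
rewrite {1}/stack => /orP[/eqP->//|/andP[+ +]].
by case: s => [|x t] // /andP[x0 xt] _; apply: stack_normalize.
Qed.

(** Two equal lengths code two runs of which the second is empty. For an even
    length both sides have the same count, so the exchange of sides is harmless;
    for an odd length there is none. *)
Lemma shade_twice b x t z : path ltn x t ->
  shade b [:: x, x & t] z = shade b (if t is [::] then [:: x] else t) z.
Proof.
have aux : run_end (b (+) ~~ odd x) x = run_end b x.
  by rewrite /run_end uphalf_half; case: b; case: (odd x).
rewrite /= aux -addbA addbb addbF; case: ifP => zx.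
  case: t => [|w t] /= => [_|/andP[xw _]]; first by rewrite zx.
  rewrite (leq_trans zx) // /run_end; case: b {aux zx}.
  - by rewrite !uphalfE half_leq // ltnW.
  - by rewrite half_leq // ltnW.
case: t => [|w t] _; first by rewrite !zx /= zx.
by rewrite zx; case: (shade b (w :: t) z) => [[]|].
Qed.

Lemma shade_normalize b y s z : stack s -> (0 < z)%N -> (0 < y)%N ->
  (y <= top s)%N || (s == [:: 0%N]) ->
  shade b (normalize (y :: s)) z = shade b (y :: s) z.
Proof.
case: s => [|x t] // ss z0 y0 /orP[/= yx|/eqP[-> ->]]; last first.
  by rewrite /=; case: ifP => // _; case: ifP => //; rewrite /run_end; case: ifP; lia.
rewrite /normalize; case: ifP => [xy|//]; have {xy} -> : y = x by lia.
rewrite -[RHS]/(shade b [:: x, x & t] z).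
rewrite shade_twice //; move: ss => /orP[/eqP[_ ->]//|].
by move=> /= /andP[/andP[]].
Qed.

(** Advancing from length [y] converts exactly the far site at distance
    [gap y]; the far side becomes the near one. *)
Lemma shade_advance_near s z : stack s -> (0 < z)%N ->
  shade true (advance s) z =
    if z == gap (top s) then Some true else shade false s z.
Proof.
case: s => [|y t] // ss z0; have -> : shade true (advance (y :: t)) z =
    shade true (y.+1 :: t) z.
  case: t ss => [|x t] // yxt; have xt := stack_behead yxt.
  rewrite /advance shade_normalize //=.
  by move: yxt; rewrite stack_cons2 => /and3P[_ ->].
rewrite /= /gap negbK; case: (ltngtP z (y./2).+1) => [zy|zy|zy] //.
  by rewrite -ltnS zy.
by rewrite leqNgt (ltn_trans _ zy).
Qed.

Lemma shade_advance_far s z : stack s -> (0 < z)%N ->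
  shade false (advance s) z = shade true s z.
Proof.
case: s => [|y t] // ss z0; have -> : shade false (advance (y :: t)) z =
    shade false (y.+1 :: t) z.
  case: t ss => [|x t] // yxt; have xt := stack_behead yxt.
  rewrite /advance shade_normalize //=.
  by move: yxt; rewrite stack_cons2 => /and3P[_ ->].
by rewrite /= negbK.
Qed.

(** A particle that lands at the near target recolours that site only; the
    alternation of colours is then read from a new innermost run. *)
Lemma shade_retreat b s z : stack s -> (0 < z)%N ->
  shade b (retreat s) z =
    if b && (z == 1%N) then Some true else omap negb (shade b s z).
Proof.
move=> ss z0; rewrite /retreat shade_normalize //.
  rewrite /= addbF /run_end; case: b => /=; last by rewrite leqNgt z0.
  by case: z z0 => [|[]].
case: s ss => [|x t] //; rewrite /stack /= orbC; case: eqP => [[-> ->]//|_] /=.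
by rewrite orbF => /andP[/andP[-> _] _].
Qed.

(** * Solving the Poisson equation on stacks *)

Section Potential.
Variables (R : realType) (kappa D : nat -> R).

(** [D y] stands for the expected total cost of an excursion, from the birth of an
    interval inside one of length [y] until it disappears. *)
Fixpoint slope (s : seq nat) : R :=
  if s is y :: t then if t is x :: _ then D x - D y - slope t else 0 else 0.

Fixpoint base_pot (l : nat) : R :=
  if l is k.+1 then base_pot k - (gap k).+1%:R * kappa k - (gap k)%:R * D k
  else 0.

(** From the stack [y :: t] with [t] starting with [x], the innermost interval
    grows to length [x] with probability [harm y / harm x]; removing it costs
    [(D x - D y) * harm y] on average. Solving the resulting recurrence along the
    stack gives increments of the form [harm y * slope]. *)
Fixpoint pot (s : seq nat) : R :=
  if s is y :: t then
    if t is [::] then base_pot y else pot t + (harm y)%:R * slope s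
  else 0.

(** Expectation of [f] at the next stack: the far target is hit with probability
    [1 / (gap y + 1)]. *)
Definition mean_step (f : seq nat -> R) (s : seq nat) : R :=
  (f (advance s) + (gap (top s))%:R * f (retreat s)) / (gap (top s)).+1%:R.

End Potential.

Section PoissonEquation.
Variables (R : realType) (kappa D : nat -> R).
Hypothesis D0 : D 0 = - kappa 0.
Hypothesis D_rec : forall y, (harm y.+1)%:R * D y.+1 =
  D y * ((harm y.+1)%:R + (gap y)%:R) + kappa y * (gap y).+1%:R.

Let G := slope D.
Let g := pot kappa D.

Lemma excursion_cost1 : D 1 = 0.
Proof. have := D_rec 0; rewrite D0 /harm /gap /= !mul1r; lra. Qed.

Lemma slope_cons y x t : G [:: y, x & t] = D x - D y - G (x :: t).
Proof. by []. Qed.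

Lemma pot_cons y x t :
  g [:: y, x & t] = g (x :: t) + (harm y)%:R * G [:: y, x & t].
Proof. by []. Qed.

(** The slope changes sign when an interval catches up with the enclosing one, so
    that the two increments cancel. *)
Lemma pot_normalize y x t : (y <= x)%N ->
  g (normalize [:: y, x & t]) = g [:: y, x & t].
Proof.
move=> yx; rewrite /normalize; case: ifP => // xy; have {yx xy} -> : y = x by lia.
rewrite pot_cons slope_cons.
case: t => [|z t]; first by rewrite /G /=; ring.
by rewrite [g [:: x, z & t]]pot_cons; ring.
Qed.

Lemma pot_retreat s : stack s -> g (retreat s) = g s + D (top s) - G s.
Proof.
case: s => [//|x t] ss; rewrite /retreat; have [x0|x0] := posnP x.
  move: ss; rewrite x0 /stack => /orP[/eqP[->]|//].
  by rewrite /g /G /= D0 /gap /=; ring.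
by rewrite pot_normalize // pot_cons slope_cons excursion_cost1 /harm /gap /=; ring.
Qed.

Lemma pot_advance s : stack s ->
  g (advance s) = g s + (gap (top s))%:R * (G s - D (top s))
                  - (gap (top s)).+1%:R * kappa (top s).
Proof.
case: s => [//|y [|x t]] ss; first by rewrite /g /G /=; ring.
rewrite /advance pot_normalize; last first.
  by move: ss; rewrite stack_cons2 => /and3P[].
rewrite !pot_cons !slope_cons /=.
have := D_rec y; rewrite harmS natrD -[(gap y).+1%:R]natr1 => E.
apply/eqP; rewrite -subr_eq0; apply/eqP.
transitivity (D y * ((harm y)%:R + (gap y)%:R + (gap y)%:R) +
    kappa y * ((gap y)%:R + 1) - ((harm y)%:R + (gap y)%:R) * D y.+1); last first.
  by rewrite E subrr.
ring.
Qed.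

Lemma mean_step_pot s : stack s -> mean_step g s = g s - kappa (top s).
Proof.
move=> ss; rewrite /mean_step pot_retreat // pot_advance //.
have : (gap (top s)).+1%:R != 0 :> R by rewrite pnatr_eq0.
rewrite -natr1 => ?; field.
by [].
Qed.

End PoissonEquation.

Section PotentialBound.
Variables (R : realType) (kappa D : nat -> R) (lip : R).
Hypothesis lip_ge0 : 0 <= lip.
Hypothesis D_lip : forall y x, (y <= x)%N -> `|D x - D y| <= lip * (x - y)%:R.

Let G := slope D.
Let g := pot kappa D.

(** The slope is an alternating sum of the increments of [D] along the stack, so it
    is at most the total variation of [D]. *)
Lemma slope_bound s : stack s -> `|G s| <= lip * (extent s - top s)%:R.
Proof.
elim: s => // y [|x t] IH ss; first by rewrite normr0 mulr_ge0.
have xt := stack_behead ss; have := IH xt.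
have := stack_top_le xt; rewrite /extent /= => xL Gx.
have yx : (y <= x)%N by move: ss; rewrite stack_cons2 => /and3P[_ /ltnW].
apply: (le_trans (ler_normB _ _)).
have -> : (last x t - y = (x - y) + (last x t - x))%N by lia.
by rewrite natrD mulrDr lerD // D_lip.
Qed.

(** Consecutive slopes nearly cancel, so the terms [harm y * slope] are
    summed by parts: removing half of the last term leaves telescoping
    increments. *)
Lemma pot_bound_half s : stack s ->
  `|g s - 2^-1 * (harm (top s))%:R * G s - base_pot kappa D (extent s)| <=
  2^-1 * lip * ((extent s)%:R * ((harm (extent s))%:R - (harm (top s))%:R)
     + (harm (extent s))%:R * (extent s - top s)%:R).
Proof.
elim: s => // y [|x t] IH ss.
  rewrite /extent /= mulr0 subr0 !subrr normr0 subnn !mulr0 addr0 mulr0 lexx //.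
have xt := stack_behead ss; have := IH xt; have := slope_bound xt.
have xL := stack_top_le xt.
have yx : (y <= x)%N by move: ss; rewrite stack_cons2 => /and3P[_ /ltnW].
rewrite [extent (y :: _)]/(extent (x :: t)) [top (y :: _)]/=.
move: xL; rewrite [top (x :: t)]/=; set L := extent _ => xL Gx Hx.
have Eg : g [:: y, x & t] = g (x :: t) + (harm y)%:R * G [:: y, x & t] by [].
have EG : G [:: y, x & t] = D x - D y - G (x :: t) by [].
rewrite Eg EG.
have -> : (L - y = (x - y) + (L - x))%N by lia.
have dxy := D_lip yx.
have hyx : (harm y)%:R <= (harm x)%:R :> R by rewrite ler_nat harm_le.
have hyL : (harm y)%:R <= (harm L)%:R :> R.
  by rewrite ler_nat harm_le // (leq_trans yx).
have GL : `|G (x :: t)| <= lip * L%:R.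
  by rewrite (le_trans Gx) // ler_wpM2l // ler_nat leq_subr.
set A := _ - _ - _ in Hx; set B := _ - _ - _.
have -> : B = A + (2^-1 * ((harm x)%:R - (harm y)%:R) * G (x :: t) +
    2^-1 * (harm y)%:R * (D x - D y)) by rewrite /A /B; field.
apply: (le_trans (ler_normD _ _)); apply: (le_trans (lerD Hx (ler_normD _ _))).
rewrite !(normrM (2^-1 * _)) [X in X * `|G _|]ger0_norm; last first.
  by rewrite mulr_ge0 ?subr_ge0.
rewrite [X in X * `|D x - _|]ger0_norm; last by rewrite mulr_ge0.
rewrite -/(extent (x :: t)) -/L.
have h1 : 2^-1 * ((harm x)%:R - (harm y)%:R) * `|G (x :: t)| <=
    2^-1 * ((harm x)%:R - (harm y)%:R) * (lip * L%:R).
  by rewrite ler_wpM2l // mulr_ge0 ?subr_ge0.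
have h2 : 2^-1 * (harm y)%:R * `|D x - D y| <=
   2^-1 * (harm L)%:R * (lip * (x - y)%:R).
  by rewrite ler_pM // ?mulr_ge0 // ler_wpM2l.
apply: (le_trans (lerD (lexx _) (lerD h1 h2))).
by rewrite natrD; lra.
Qed.

Lemma pot_bound s : stack s ->
  `|g s| <= `|base_pot kappa D (extent s)| + 2 * lip * (extent s)%:R * (harm (extent s))%:R.
Proof.
move=> ss; have := pot_bound_half ss; have := slope_bound ss.
have tL := stack_top_le ss.
set L := extent s in tL *; set y := top s in tL *; set b := base_pot _ _ _.
move=> Gs H.
have hyL : (harm y)%:R <= (harm L)%:R :> R by rewrite ler_nat harm_le.
have -> : g s = (g s - 2^-1 * (harm y)%:R * G s - b) + 2^-1 * (harm y)%:R * G s + b.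
  ring.
apply: (le_trans (ler_normD _ _)); rewrite addrC lerD //.
apply: (le_trans (ler_normD _ _)).
have Ly : (L - y)%:R <= L%:R :> R by rewrite ler_nat leq_subr.
have h1 : `|2^-1 * (harm y)%:R * G s| <= 2^-1 * (harm L)%:R * (lip * L%:R).
  rewrite normrM [X in X * _]ger0_norm ?mulr_ge0 //.
  rewrite ler_pM ?mulr_ge0 ?ler_wpM2l //.
  by rewrite (le_trans Gs) // ler_wpM2l.
apply: (le_trans (lerD H h1)).
have h3 : L%:R * ((harm L)%:R - (harm y)%:R) <= L%:R * (harm L)%:R :> R.
  by rewrite ler_wpM2l // gerBl.
have h4 : (harm L)%:R * (L - y)%:R <= (harm L)%:R * L%:R :> R by rewrite ler_wpM2l.
have := ler_wpM2l lip_ge0 (lerD h3 h4).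
have : 0 <= lip * ((harm L)%:R * L%:R) by rewrite !mulr_ge0.
lra.
Qed.

End PotentialBound.

(** * The two potentials *)

Section QuarticPotential.
Variable R : realType.

Let kap (y : nat) : R := - (gap y)%:R.
Let D (y : nat) : R := 1 - (harm y)%:R.

Definition quartic_pot : seq nat -> R := pot kap D.

Lemma mean_step_quartic s : stack s ->
  mean_step quartic_pot s = quartic_pot s + (gap (top s))%:R.
Proof.
move=> ss; rewrite /quartic_pot mean_step_pot // ?opprK // /kap /D.
  by rewrite /harm /gap /=; ring.
by move=> y; rewrite harmS natrD -[(gap y).+1%:R]natr1; ring.
Qed.

Lemma base_quartic l : 2^-1 * (harm l)%:R ^+ 2 <= base_pot kap D l.
Proof.
elim: l => [|l IH]; first by rewrite /= /harm /= expr0n mulr0.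
rewrite [base_pot _ _ _]/= harmS natrD -[(gap l).+1%:R]natr1 /kap /D.
have : 0 <= (gap l)%:R ^+ 2 :> R by exact: sqr_ge0.
move: IH; lra.
Qed.

(** Up to the contribution of the bottom interval the potential is half of a sum
    of two squares [u ^ 2 + v ^ 2] with [u + v] fixed: pushing an interval moves its harmonic length from one
    of [u], [v] to the other. *)
Lemma quartic_squares s : stack s -> exists u v : R,
  [/\ u + v = (harm (extent s))%:R,
      slope D s = v - u - (harm (top s))%:R &
      quartic_pot s - base_pot kap D (extent s) + 2^-1 * (harm (extent s))%:R ^+ 2 =
        2^-1 * (u ^+ 2 + v ^+ 2)].
Proof.
elim: s => // y [|x t] IH ss.
  exists 0, (harm y)%:R; rewrite /quartic_pot /extent /=; split; ring.
have [u [v [uv Gx E]]] := IH (stack_behead ss).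
exists (v - (harm y)%:R), (u + (harm y)%:R).
have Eg : quartic_pot [:: y, x & t] =
  quartic_pot (x :: t) + (harm y)%:R * slope D [:: y, x & t] by [].
have EG : slope D [:: y, x & t] = D x - D y - slope D (x :: t) by [].
rewrite Eg EG Gx /D [top (_ :: _ :: _)]/= [top (x :: t)]/=.
rewrite -[extent [:: y, x & t]]/(extent (x :: t)); split.
- by rewrite -uv; ring.
- by ring.
- move: E; set P := quartic_pot _; set B := base_pot _ _ _; set h := _ ^+ 2 => E.
  have -> : P = B - 2^-1 * h + 2^-1 * (u ^+ 2 + v ^+ 2) by rewrite -E; ring.
  by field.
Qed.

Lemma extent4_le_quartic s : stack s ->
  (extent s).+1%:R ^+ 4 <= 128 * quartic_pot s + 2.
Proof.
move=> ss; have [u [v [uv _ E]]] := quartic_squares ss.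
have := base_quartic (extent s).
have : 4^-1 * (harm (extent s))%:R ^+ 2 <= 2^-1 * (u ^+ 2 + v ^+ 2) :> R.
  by rewrite -uv; have := sqr_ge0 (u - v); lra.
rewrite -E => h1 h2.
have : (harm (extent s))%:R ^+ 2 <= 4 * quartic_pot s :> R by lra.
have : (extent s).+1%:R ^+ 2 <= 4 * (harm (extent s))%:R + 1 :> R.
  by rewrite -natrX -natrM natr1 ler_nat sqr_le_harm.
set h : R := (harm _)%:R; set l : R := _.+1%:R => h3 h4.
have h0 : 0 <= h by [].
have : (l ^+ 2) ^+ 2 <= (4 * h + 1) ^+ 2.
  by rewrite ler_pXn2r // nnegrE ?sqr_ge0 //; lra.
rewrite -exprM; have := sqr_ge0 (4 * h - 1); lra.
Qed.

End QuarticPotential.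

Section CubicPotential.
Variable R : realType.

Let a (j : nat) : R := 1 / (j%:R * (j%:R + 1) ^+ 2 * (j%:R + 2)).
Let S (m : nat) : R := \sum_(1 <= j < m) a j.

Lemma alphaE : alpha R = (1 / 2 - limn S)^-1.
Proof. by []. Qed.

(** For [0 < y], the expected number of particles that settle during an excursion
    inside an interval of length [y], after the one that starts it, is
    [harm y.+2 * rate y], and their expected number of steps is [harm y - 1]. So
    [alpha] must be the inverse of the limit of [rate]. *)
Definition rate (y : nat) : R :=
  - 2^-1 + \sum_(0 <= z < y) (gap z).+1%:R / ((harm z.+1)%:R * (harm z.+3)%:R).

Lemma rateS y : rate y.+1 =
  rate y + (gap y).+1%:R / ((harm y.+1)%:R * (harm y.+3)%:R).
Proof. by rewrite /rate big_nat_recr //= addrA. Qed.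

Lemma harm_gt0 y : 0 < (harm y.+1)%:R :> R.
Proof. by rewrite ltr0n /harm. Qed.

Lemma rate_le x y : (x <= y)%N -> rate x <= rate y.
Proof.
move=> /subnK <-; elim: (y - x)%N => // k IH; rewrite addSn rateS (le_trans IH) //.
by rewrite lerDl divr_ge0 // mulr_ge0 // ltW ?harm_gt0.
Qed.

(** The remainder of the series is at most [2 / harm y.+2], which makes the second
    term of [D] below accurate up to a bounded error. *)
Lemma rate_upper x y : (x <= y)%N ->
  rate y + 2 / (harm y.+2)%:R <= rate x + 2 / (harm x.+2)%:R.
Proof.
move=> /subnK <-; elim: (y - x)%N => // k IH; rewrite addSn; apply: le_trans IH.
move: (k + x)%N => {k x}y; rewrite rateS -addrA lerD2l -lerBrDr.
have h1 := harm_gt0 y; have h2 := harm_gt0 y.+1; have h3 := harm_gt0 y.+2.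
have -> : 2 / (harm y.+2)%:R - 2 / (harm y.+3)%:R =
   2 * (gap y).+1%:R / ((harm y.+2)%:R * (harm y.+3)%:R) :> R.
  have -> : (gap y).+1%:R = (harm y.+3)%:R - (harm y.+2)%:R :> R.
    have -> : harm y.+3 = (harm y.+2 + (gap y).+1)%N by rewrite (harmS y.+2).
    by rewrite natrD; ring.
  by field; rewrite !gt_eqF.
have h4 : (harm y.+1)%:R^-1 <= 2 / (harm y.+2)%:R :> R.
  rewrite ler_pdivlMr // mulrC ler_pdivrMr // -natrM ler_nat.
  rewrite /harm /gap /=; have := odd_double_half y.
  rewrite uphalf_half /=; case: (odd y) => /=; nia.
have -> : (gap y).+1%:R / ((harm y.+1)%:R * (harm y.+3)%:R) =
    (gap y).+1%:R / (harm y.+3)%:R * (harm y.+1)%:R^-1 :> R.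
  by field; rewrite !gt_eqF.
have -> : 2 * (gap y).+1%:R / ((harm y.+2)%:R * (harm y.+3)%:R) =
    (gap y).+1%:R / (harm y.+3)%:R * (2 / (harm y.+2)%:R) :> R.
  by field; rewrite !gt_eqF.
by rewrite ler_wpM2l // divr_ge0 // ltW.
Qed.

(** Grouping the terms of [rate] in pairs and adding the series that defines the
    limit leaves a telescoping sum. *)
Lemma rate_odd m :
  rate m.*2.+1 = 1 / 2 - S m.+1 - ((m.+1)%:R * (m.+2)%:R)^-1.
Proof.
elim: m => [|m IH].
  rewrite /rate /S big_nat1 big_geq // /harm /gap /=; by field.
rewrite doubleS 2!rateS IH /S [in RHS]big_nat_recr //= /a.
have e2 k : harm k.*2 = (k * k.+1)%N.
  by rewrite /harm /gap uphalf_half odd_double !doubleK.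
have e1 k : harm k.*2.+1 = (k.+1 * k.+1)%N.
  by rewrite /harm /gap uphalfE -doubleS doubleK /= uphalf_double.
have g1 k : gap k.*2.+1 = k.+1 by rewrite /gap /= uphalf_double.
have g2 k : gap k.*2 = k.+1 by rewrite /gap doubleK.
rewrite -!doubleS !e1 !e2 g1 g2 !natrM -!natr1.
have m0 : 0 <= m%:R :> R by [].
set x : R := m%:R in m0 *; field.
by rewrite !gt_eqF //=; lra.
Qed.

Let a_ge0 j : 0 <= a j.
Proof. by rewrite /a divr_ge0 // !mulr_ge0 // ?exprn_ge0 // ?addr_ge0. Qed.

Lemma partial_le_half m : S m <= 1 / 2.
Proof.
apply: le_trans (_ : S m.+1 <= _).
  rewrite /S; case: m => [|m]; first by rewrite !big_geq.
  by rewrite [leRHS]big_nat_recr //= lerDl a_ge0.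
have := rate_odd m; have := @rate_le 1 m.*2.+1 isT.
have -> : rate 1 = 0 by rewrite /rate big_nat1 /harm /gap /=; field.
move=> h1 h2.
have : 0 <= ((m.+1)%:R * (m.+2)%:R)^-1 :> R by rewrite invr_ge0 mulr_ge0.
by move: h1; rewrite h2; move: ((_ * _)^-1) => e h e0; lra.
Qed.

Lemma partial_nondecreasing : {homo S : m n / (m <= n)%N >-> m <= n}.
Proof.
move=> m n mn; rewrite /S; have [m1|m1] := leqP m 1.
  rewrite big_geq //; exact: sumr_ge0.
rewrite [leRHS](@big_cat_nat _ _ _ m) ?(ltnW m1) //= lerDl; exact: sumr_ge0.
Qed.

Lemma partial_cvg : cvgn S.
Proof.
apply: nondecreasing_is_cvgn; first exact: partial_nondecreasing.
by exists (1 / 2) => _ [n _ <-]; exact: partial_le_half.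
Qed.

Lemma partial_lim m : S m <= limn S.
Proof. by apply: nondecreasing_cvgn_le; [exact: partial_nondecreasing|exact: partial_cvg]. Qed.

Lemma rate_alpha y : rate y <= (alpha R)^-1 <= rate y + 2 / (harm y.+2)%:R.
Proof.
rewrite alphaE invrK; apply/andP; split.
  rewrite lerBrDr addrC -lerBrDr; apply: limr_le; first exact: partial_cvg.
  apply: nearW => n; apply: le_trans (partial_nondecreasing (_ : n <= (n + y).+1)%N) _.
    by rewrite ltnW // ltnS leq_addr.
  have yn : (y <= (n + y).*2.+1)%N by lia.
  have h := rate_odd (n + y); have := rate_le yn; rewrite h.
  have : 0 <= ((n + y).+1%:R * (n + y).+2%:R)^-1 :> R by rewrite invr_ge0 mulr_ge0.
  by move: ((_ * _)^-1) => e e0 {}h; lra.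
have yn : (y <= y.*2.+1)%N by lia.
apply: le_trans (rate_upper yn); rewrite rate_odd.
have -> : harm y.*2.+3 = (y.+2 * y.+2)%N.
  by rewrite /harm /gap uphalfE -!doubleS doubleK /= uphalf_double.
have h : (y.+1%:R * y.+2%:R)^-1 <= 2 / (y.+2 * y.+2)%:R :> R.
  rewrite -[leLHS]mul1r ler_pdivlMr ?ltr0n // mulrAC ler_pdivrMr ?mulr_gt0 ?ltr0n //.
  by rewrite -!natrM mul1r ler_nat; nia.
have := partial_lim y.+1; move: h; move: ((_ * _)^-1) (2 / _%:R) => e e'; lra.
Qed.

Lemma alpha_gt0 : 0 < alpha R.
Proof.
rewrite -invr_gt0; have /andP[h _] := rate_alpha 2; apply: lt_le_trans h.
by rewrite /rate /harm /gap big_nat_recr //= big_nat1 /= -!natrM; lra.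
Qed.

Let kap (y : nat) : R := (gap y)%:R - alpha R.
Let D (y : nat) : R := (harm y)%:R - 1 - alpha R * (harm y.+2)%:R * rate y.

Definition cubic_pot : seq nat -> R := pot kap D.

Let D0 : D 0 = - kap 0.
Proof. by rewrite /D /kap /rate /harm /gap big_geq //=; lra. Qed.

Let D_rec y : (harm y.+1)%:R * D y.+1 =
  D y * ((harm y.+1)%:R + (gap y)%:R) + kap y * (gap y).+1%:R.
Proof.
have h1 := harm_gt0 y; have h3 := harm_gt0 y.+2.
rewrite /D rateS /kap.
have e : (harm y.+3)%:R * (harm y.+1)%:R =
   (harm y.+2)%:R * ((harm y.+1)%:R + (gap y)%:R) :> R.
  rewrite -natrD -!natrM; congr _%:R; rewrite /harm /gap /=.
  have := odd_double_half y.
  by rewrite uphalf_half /=; case: (odd y) => /=; nia.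
have -> : (harm y.+1)%:R * ((harm y.+1)%:R - 1 - alpha R * (harm y.+3)%:R *
   (rate y + (gap y).+1%:R / ((harm y.+1)%:R * (harm y.+3)%:R))) =
   (harm y.+1)%:R * ((harm y.+1)%:R - 1) - alpha R * rate y *
    ((harm y.+3)%:R * (harm y.+1)%:R) - alpha R * (gap y).+1%:R.
  by field; rewrite !gt_eqF.
by rewrite e harmS natrD -[(gap y).+1%:R]natr1; ring.
Qed.

Lemma mean_step_cubic s : stack s ->
  mean_step cubic_pot s = cubic_pot s - ((gap (top s))%:R - alpha R).
Proof. by move=> ss; rewrite /cubic_pot mean_step_pot. Qed.

(** The quadratic parts of steps and particles cancel and leave a linear cost; this
    is what makes the potential cubic instead of quartic. *)
Lemma excursion_cost_bound y :
  - (y%:R + 3) <= D y <= - (y%:R + 3) + 2 * alpha R.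
Proof.
have /andP[h1 h2] := rate_alpha y; have a0 := alpha_gt0.
have H := harm_gt0 y.+1.
have -> : D y = - (y%:R + 3) + alpha R * (harm y.+2)%:R * ((alpha R)^-1 - rate y).
  have e : alpha R * (harm y.+2)%:R * (alpha R)^-1 = (harm y.+2)%:R.
    by rewrite mulrAC divff ?gt_eqF // mul1r.
  rewrite mulrBr e /D.
  suff -> : harm y.+2 = (harm y + y + 2)%N by rewrite !natrD; ring.
  rewrite !harmS /gap /=; have := odd_double_half y.
  by rewrite uphalf_half; lia.
rewrite lerDl lerD2l mulr_ge0 ?subr_ge0 ?mulr_ge0 //=; last exact: ltW.
rewrite -mulrA [leRHS]mulrC ler_pM2l // mulrC -ler_pdivlMr //; lra.
Qed.

Let lip : R := 1 + 2 * alpha R.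

Let lip_ge0 : 0 <= lip. Proof. have := alpha_gt0; rewrite /lip; lra. Qed.

Let D_lip y x : (y <= x)%N -> `|D x - D y| <= lip * (x - y)%:R.
Proof.
rewrite leq_eqVlt => /orP[/eqP->|yx]; first by rewrite subrr normr0 subnn mulr0.
have := excursion_cost_bound y; have := excursion_cost_bound x; have := alpha_gt0.
have x1 : 1 <= (x - y)%:R :> R by rewrite ler1n subn_gt0.
have e : x%:R = (x - y)%:R + y%:R :> R by rewrite -natrD subnK // ltnW.
rewrite e /lip; set w : R := (x - y)%:R in x1 * => a0 /andP[h1 h2] /andP[h3 h4].
have : alpha R <= alpha R * w by rewrite ler_pMr.
rewrite ler_norml; move=> h5; apply/andP; split; lra.
Qed.

Lemma base_cubic l :
  `|base_pot kap D l| <= (8 + 4 * alpha R) * l.+1%:R ^+ 3.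
Proof.
have a0 := alpha_gt0.
elim: l => [|l IH]; first by rewrite normr0 mulr_ge0 // addr_ge0 // mulr_ge0 // ltW.
have := excursion_cost_bound l; move: IH.
rewrite [base_pot _ _ _.+1]/= /kap -[l.+2%:R]natr1 -[(gap l).+1%:R]natr1.
have g1 : (gap l)%:R <= l.+1%:R :> R by rewrite ler_nat gap_le.
have g0 : 1 <= (gap l)%:R :> R by rewrite ler1n.
rewrite -[l.+1%:R]natr1; have := ler0n R l.
move: g1; rewrite -[l.+1%:R]natr1.
set c : R := (gap l)%:R in g0 *; set x : R := l%:R; set b := base_pot _ _ _.
set d := D l; set A := alpha R in a0 * => cx x0 IH /andP[d1 d2].
have h1 : `|(c + 1) * (c - A)| <= (x + 2) * (x + 1 + A).
  rewrite normrM ler_pM //; first by rewrite ger0_norm; lra.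
  by rewrite ler_norml; apply/andP; split; lra.
have h2 : `|c * d| <= (x + 1) * (x + 3 + 2 * A).
  rewrite normrM ler_pM //; first by rewrite ger0_norm; lra.
  by rewrite ler_norml; apply/andP; split; lra.
apply: (le_trans (ler_normB _ _)); apply: (le_trans (lerD (ler_normB _ _) h2)).
apply: (le_trans (lerD (lerD IH h1) (lexx _))).
have : 0 <= A * x by rewrite mulr_ge0 // ltW.
have : 0 <= A * x ^+ 2 by rewrite mulr_ge0 ?sqr_ge0 // ltW.
have := sqr_ge0 x; lra.
Qed.

Lemma cubic_bound s : stack s ->
  `|cubic_pot s| <= (10 + 8 * alpha R) * (extent s).+1%:R ^+ 3.
Proof.
move=> ss; apply: (le_trans (pot_bound kap lip_ge0 D_lip ss)).
have a0 := alpha_gt0.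
have -> : (10 + 8 * alpha R) * (extent s).+1%:R ^+ 3 =
   (8 + 4 * alpha R) * (extent s).+1%:R ^+ 3 + 2 * lip * ((extent s).+1%:R ^+ 3).
  by rewrite /lip; ring.
rewrite lerD ?base_cubic // -mulrA ler_wpM2l ?mulr_ge0 // exprS.
by rewrite ler_pM // ?ler_nat // -natrX ler_nat harm_le_sqr.
Qed.

Lemma cubic_retreat_bound s : stack s ->
  `|cubic_pot (retreat s) - cubic_pot s| <= (4 + 6 * alpha R) * (extent s).+1%:R.
Proof.
move=> ss; rewrite [X in `|X|](_ : _ = D (top s) - slope D s); last first.
  by rewrite /cubic_pot pot_retreat //; ring.
have tL := stack_top_le ss; have := slope_bound lip_ge0 D_lip ss.
have := excursion_cost_bound (top s); have a0 := alpha_gt0.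
move: (D _) (slope _ _) => d G /andP[d1 d2] G1.
have G2 : `|G| <= lip * (extent s)%:R.
  by rewrite (le_trans G1) // ler_wpM2l // ler_nat leq_subr.
have tL' : (top s)%:R <= (extent s)%:R :> R by rewrite ler_nat.
have d3 : `|d| <= (extent s)%:R + 3 + 2 * alpha R.
  have : 0 <= (top s)%:R :> R by [].
  by move=> ?; rewrite ler_norml; apply/andP; split; lra.
apply: (le_trans (ler_normB _ _)); apply: (le_trans (lerD d3 G2)).
rewrite -natr1 /lip.
have : 0 <= alpha R * (extent s)%:R by rewrite mulr_ge0 // ltW.
have : 0 <= (extent s)%:R :> R by [].
lra.
Qed.

End CubicPotential.

(** * Growth of the stack *)

Section Growth.
Variable R : realType.
Implicit Types (f h : seq nat -> R) (s : seq nat).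

Definition cube (s : seq nat) : R := (extent s).+1%:R ^+ 3.
Definition fourth (s : seq nat) : R := (extent s).+1%:R ^+ 4.

Definition mean_after (n : nat) f : seq nat -> R := iter n (@mean_step R) f.

Lemma mean_afterSr n f s : mean_after n.+1 f s = mean_after n (@mean_step R f) s.
Proof. by rewrite /mean_after iterSr. Qed.

Lemma mean_step_le f h s : stack s -> (forall t, stack t -> f t <= h t) ->
  mean_step f s <= mean_step h s.
Proof.
move=> ss fh; rewrite /mean_step ler_wpM2r // lerD ?ler_wpM2l ?fh //.
- exact: stack_advance.
- exact: stack_retreat.
Qed.

Lemma mean_after_le n f h s : stack s -> (forall t, stack t -> f t <= h t) ->
  mean_after n f s <= mean_after n h s.
Proof.
move=> ss fh; elim: n s ss => [|n IH] s ss; first exact: fh.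
exact: mean_step_le.
Qed.

Lemma mean_after_linear n a f b h s :
  mean_after n (fun t => a * f t + b * h t) s =
  a * mean_after n f s + b * mean_after n h s.
Proof.
elim: n s => [//|n IH] s; rewrite /mean_after !iterS /mean_step -!/(mean_after _ _ _).
by rewrite !IH; field; rewrite addrC natr1 pnatr_eq0.
Qed.

Lemma mean_after_cst n c s : mean_after n (fun=> c) s = c.
Proof.
elim: n s => [//|n IH] s; rewrite /mean_after iterS /mean_step -!/(mean_after _ _ _).
by rewrite !IH; field; rewrite addrC natr1 pnatr_eq0.
Qed.

Lemma mean_after_affine n a f b s :
  mean_after n (fun t => a * f t + b) s = a * mean_after n f s + b.
Proof.
have := mean_after_linear n a f b (fun=> 1) s; rewrite mean_after_cst mulr1 => <-.
by congr (mean_after n _ s); apply/funext => t; rewrite mulr1.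
Qed.

Lemma mean_after_pot n f h s : stack s ->
  (forall t, stack t -> mean_step f t = f t + h t) ->
  mean_after n f s = f s + \sum_(0 <= i < n) mean_after i h s.
Proof.
move=> ss fh; elim: n => [|n IH]; first by rewrite big_geq ?addr0.
rewrite big_nat_recr // addrA -IH mean_afterSr.
have := mean_after_linear n 1 f 1 h s; rewrite !mul1r => <-.
by apply/eqP; rewrite eq_le !mean_after_le // => t tt; rewrite fh // !mul1r.
Qed.

(** Young's inequality; it lets the quartic moment absorb the cubic one. *)
Lemma cube_le (d : R) s : 0 < d -> cube s <= d * fourth s + d^-1 ^+ 3.
Proof.
move=> d0; rewrite /cube /fourth; set x : R := _.+1%:R.
have x0 : 0 <= x by [].
have d1 : 0 < d^-1 by rewrite invr_gt0.
have [xd|/ltW xd] := leP x d^-1.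
  rewrite (@le_trans _ _ (d^-1 ^+ 3)) ?ler_pXn2r ?nnegrE ?(ltW d1) //.
  by rewrite lerDr mulr_ge0 ?exprn_ge0 // ltW.
rewrite (@le_trans _ _ (d * x ^+ 4)) ?lerDl ?exprn_ge0 ?(ltW d1) //.
rewrite [x ^+ 4]exprS mulrA ler_peMl ?exprn_ge0 //.
by rewrite -(@divff _ d) ?gt_eqF // ler_wpM2l // ltW.
Qed.

(** The quartic potential grows by the number of steps, and the number of steps is
    [alpha * n] up to the cubic potential: the fourth moment is bounded by
    [O(n)] plus a third moment that it absorbs. *)
Lemma fourth_growth : exists A B : R, [/\ 0 <= A, 0 <= B &
  forall n, mean_after n fourth [:: 0%N] <= A * n%:R + B].
Proof.
have [M EM] : exists M : R, M = 256 by exists 256.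
have M0 : 0 < M by rewrite EM ltr0n.
have a0 := alpha_gt0 R; pose K := 10 + 8 * alpha R; pose d := (M * K)^-1.
have K0 : 0 < K by rewrite /K; lra.
have d0 : 0 < d by rewrite invr_gt0 mulr_gt0.
exists (M * alpha R), (4 + M * K * d^-1 ^+ 3); split.
- by rewrite mulr_ge0 ?ltW.
- by rewrite addr_ge0 ?mulr_ge0 ?exprn_ge0 ?invr_ge0 ?mulr_ge0 ?ltW.
move=> n; have s0 : stack [:: 0%N] by [].
have q : mean_after n fourth [:: 0%N] <=
    128 * mean_after n (@quartic_pot R) [:: 0%N] + 2.
  rewrite -mean_after_affine; apply: mean_after_le => // t tt.
  exact: extent4_le_quartic.
rewrite (mean_after_pot n s0 (@mean_step_quartic R)) add0r in q.
have c := mean_after_pot n s0 (@mean_step_cubic R).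
have c' : - (K * mean_after n cube [:: 0%N]) <=
    mean_after n (@cubic_pot R) [:: 0%N].
  have := mean_after_affine n (- K) cube 0 [:: 0%N]; rewrite addr0 mulNr => <-.
  apply: mean_after_le => // t tt.
  by have := cubic_bound R tt; rewrite addr0 ler_norml mulNr => /andP[].
have e : \sum_(0 <= i < n)
    mean_after i (fun s => - ((gap (top s))%:R - alpha R)) [:: 0%N] =
  alpha R * n%:R -
    \sum_(0 <= i < n) mean_after i (fun s => (gap (top s))%:R) [:: 0%N].
  have -> : alpha R * n%:R = \sum_(0 <= i < n) alpha R.
    by rewrite sumr_const_nat subn0 mulr_natr.
  rewrite -sumrB; apply: eq_bigr => i _.
  have := mean_after_affine i (-1) (fun s => (gap (top s))%:R) (alpha R) [:: 0%N].
  rewrite mulN1r addrC => <-; congr (mean_after i _ _).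
  by apply/funext => t; ring.
rewrite c e add0r in c'.
have y : mean_after n cube [:: 0%N] <=
     d * mean_after n fourth [:: 0%N] + d^-1 ^+ 3.
  rewrite -mean_after_affine; apply: mean_after_le => // t _; exact: cube_le.
have := ler_wpM2l (ltW K0) y.
have -> : K * (d * mean_after n fourth [:: 0%N] + d^-1 ^+ 3) =
  mean_after n fourth [:: 0%N] / M + K * d^-1 ^+ 3.
  by rewrite /d; field; rewrite !gt_eqF.
move: (\sum_(_ <= _ < _) _) (K * mean_after _ _ _) c' q (d^-1 ^+ 3).
(* [d] was chosen so that the cubic term takes up half of the quartic one. *)
rewrite EM; move=> S T h1 h2 E h3; lra.
Qed.

Lemma cube_growth : exists A B : R, [/\ 0 <= A, 0 <= B &
  forall (d : R) n, 0 < d ->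
    mean_after n cube [:: 0%N] <= d * (A * n%:R + B) + d^-1 ^+ 3].
Proof.
have [A [B [A0 B0 H]]] := fourth_growth; exists A, B; split => // d n d0.
apply: (@le_trans _ _ (d * mean_after n fourth [:: 0%N] + d^-1 ^+ 3)).
  by rewrite -mean_after_affine; apply: mean_after_le => // t _; exact: cube_le.
by rewrite lerD2r ler_wpM2l // ltW.
Qed.

End Growth.

(** * Countable-valued functions and independence from the future *)

(** Measurability for the discrete structure on [S]. For countable [S] it passes
    through case distinctions on the value of [Z] ([adapted_bind]). *)
Definition adapted (T S : Type) (G : set (set T)) (Z : T -> S) : Prop :=
  forall B : set S, G (Z @^-1` B).

Section Adapted.
Variables (T : Type) (G : set (set T)).
Hypothesis GS : sigma_algebra setT G.

Lemma sigma_bigcup (I : countType) (A : I -> set T) :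
  (forall i, G (A i)) -> G (\bigcup_i A i).
Proof.
case: GS => G0 _ GU GA.
rewrite (_ : \bigcup_i _ = \bigcup_k (if choice.unpickle k is Some i then A i else set0)).
  by apply: GU => k; case: choice.unpickle.
apply/seteqP; split => [w [i _ Aw]|w [k _]].
  by exists (choice.pickle i) => //; rewrite choice.pickleK.
by case: choice.unpickle => // i Aw; exists i.
Qed.

Lemma sigma_setC (A : set T) : G A -> G (~` A).
Proof. by case: GS => _ GC _ /GC; rewrite setTD. Qed.

Lemma sigma_setT : G setT.
Proof. by case: GS => G0 _ _; rewrite -setC0; exact: sigma_setC. Qed.

Lemma sigma_setU (A B : set T) : G A -> G B -> G (A `|` B).
Proof.
move=> GA GB; rewrite (_ : _ `|` _ = \bigcup_(b : bool) (if b then A else B)).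
  by apply: sigma_bigcup => -[].
apply/seteqP; split => [w [Aw|Bw]|w [[] _]]; [by exists true|by exists false|by left|by right].
Qed.

Lemma sigma_setI (A B : set T) : G A -> G B -> G (A `&` B).
Proof.
by move=> GA GB; rewrite -[_ `&` _]setCK setCI; apply/sigma_setC/sigma_setU; exact: sigma_setC.
Qed.

Lemma sigma_bigcap (I : countType) (A : I -> set T) :
  (forall i, G (A i)) -> G (\bigcap_i A i).
Proof.
by move=> GA; rewrite -[\bigcap_i _]setCK setC_bigcap; apply/sigma_setC/sigma_bigcup => i;
  exact: sigma_setC.
Qed.

Lemma adapted_cst (S : Type) (c : S) : adapted G (fun=> c).
Proof.
move=> B; have [Bc|Bc] := pselect (B c).
  by rewrite (_ : _ @^-1` _ = setT); [exact: sigma_setT|apply/seteqP; split].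
by rewrite (_ : _ @^-1` _ = set0); [case: GS|apply/seteqP; split].
Qed.

Lemma adapted_comp (S S' : Type) (f : S -> S') (Z : T -> S) :
  adapted G Z -> adapted G (f \o Z).
Proof. by move=> GZ B; exact: (GZ (f @^-1` B)). Qed.

Lemma adapted_bind (S : countType) (S' : Type) (Z : T -> S) (f : S -> T -> S') :
  adapted G Z -> (forall z, adapted G (f z)) -> adapted G (fun w => f (Z w) w).
Proof.
move=> GZ Gf B.
rewrite (_ : _ @^-1` _ = \bigcup_z (Z @^-1` [set z] `&` f z @^-1` B)).
  by apply: sigma_bigcup => z; apply: sigma_setI; [exact: GZ|exact: Gf].
by apply/seteqP; split => [w Bw|w [z _ [/= <-]]//]; exists (Z w).
Qed.

Lemma adapted_fibers (S : countType) (Z : T -> S) :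
  (forall z, G (Z @^-1` [set z])) -> adapted G Z.
Proof.
move=> GZ B; rewrite (_ : _ @^-1` _ = \bigcup_z (if `[< B z >] then Z @^-1` [set z] else set0)).
  by apply: sigma_bigcup => z; case: ifP => // _; case: GS.
apply/seteqP; split => [w Bw|w [z _]]; first by exists (Z w); rewrite ?asboolT.
by case: ifP => // /asboolP Bz /= ->.
Qed.

End Adapted.

Section FutureIndependence.
Context d (T : measurableType d) (R : realType) (P : probability T R).
Variable F : nat -> set (set T).
Hypothesis F_measurable : forall i, F i `<=` measurable.

(** Events independent of all inputs of index at least [m]. Stating independence
    of products of inputs, and not of the generated sigma-algebra, makes the class
    stable under countable disjoint unions and under conditioning on one more
    input, which is all that a chain requires. *)
Definition indep_future (m : nat) (A : set T) : Prop := measurable A /\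
  forall (J : {fset nat}) (E : nat -> set T),
    (forall i, i \in J -> (m <= i)%N /\ F i (E i)) ->
    P (A `&` \bigcap_(i in [set` J]) E i) = (P A * \prod_(i <- J) P (E i))%E.

Lemma indep_future_setT (D : set nat) m : mutually_independent P D F ->
  (forall i, (m <= i)%N -> D i) -> indep_future m setT.
Proof.
move=> ind mD; split => // J E JE.
rewrite setTI probability_setT mul1e; apply: ind => i /=; first by move=> /JE[/mD].
by move=> /JE[].
Qed.

Lemma indep_futureI m A E : indep_future m A -> F m E -> P (A `&` E) = (P A * P E)%E.
Proof.
move=> [mA iA] FE; have := iA [fset m]%fset (fun=> E).
rewrite set_fset1 bigcap_set1 big_seq_fset1; apply => i.
by rewrite inE => /eqP ->.
Qed.

Lemma indep_future_step m A E : indep_future m A -> F m E -> indep_future m.+1 (A `&` E).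
Proof.
move=> iA FE; have [mA hA] := iA; split => [|J E' JE].
  by apply: measurableI => //; exact: F_measurable FE.
have mJ : m \notin J by apply/negP => /JE[]; rewrite ltnn.
pose E'' i := if i == m then E else E' i.
have JE'' i : i \in J -> E'' i = E' i.
  by move=> iJ; rewrite /E''; case: eqP => // im; rewrite im (negbTE mJ) in iJ.
have := hA (m |` J)%fset E''; rewrite bigcap_fsetU1 big_fsetU1 //=.
have -> : E'' m = E by rewrite /E'' eqxx.
rewrite (indep_futureI iA FE) -setIA -muleA.
rewrite (eq_bigcapr (_ : forall i, [set` J] i -> E'' i = E' i)) //.
have -> : (\prod_(i <- J) P (E'' i) = \prod_(i <- J) P (E' i))%E.
  by rewrite !big_seq; apply: eq_bigr => i iJ; rewrite JE''.
apply => i; rewrite in_fset1U /E''; case: eqP => [->//|_ /= /JE[/ltnW]].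
by split.
Qed.

Lemma measurable_bigcap_fset m (J : {fset nat}) (E : nat -> set T) :
  (forall i, i \in J -> (m <= i)%N /\ F i (E i)) ->
  measurable (\bigcap_(i in [set` J]) E i).
Proof.
move=> JE; apply: fin_bigcap_measurable => // i /= /JE[_]; exact: F_measurable.
Qed.

Lemma indep_future_bigcup m (A : nat -> set T) : trivIset setT A ->
  (forall k, indep_future m (A k)) -> indep_future m (\bigcup_k A k).
Proof.
move=> tA iA; split => [|J E JE]; first by apply: bigcupT_measurable => k; case: (iA k).
have mE := measurable_bigcap_fset JE; set B := \bigcap_(_ in _) _ in mE *.
rewrite setI_bigcupl measure_bigcup //=; last 2 first.
- by move=> k _; apply: measurableI => //; case: (iA k).
- exact: trivIset_setIr.
rewrite measure_bigcup //=; last by move=> k _; case: (iA k).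
have [c c0 Ec] : exists2 c : R, 0 <= c & (\prod_(i <- J) P (E i))%E = c%:E.
  have f : (\prod_(i <- J) P (E i))%E \is a fin_num.
    rewrite big_seq prode_fin_num // => i /JE[_ /F_measurable mEi].
    exact: fin_num_measure.
  by exists (fine (\prod_(i <- J) P (E i))%E); rewrite ?fineK // fine_ge0 ?prode_ge0.
rewrite Ec muleC -nneseriesZl; last by move=> k _; exact: measure_ge0.
by apply: eq_eseriesr => k _; case: (iA k) => _ ->; rewrite // Ec muleC.
Qed.

Lemma indep_future_set0 m : indep_future m set0.
Proof.
by split => // J E _; rewrite set0I measure0 mul0e.
Qed.

Lemma indep_future_partition (S : countType) (Z : T -> S) (E : S -> set T) m :
  (forall z, indep_future m (Z @^-1` [set z] `&` E z)) ->
  indep_future m [set w | E (Z w) w].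
Proof.
move=> iZ; pose A k := if choice.unpickle k is Some z then
  (if choice.pickle z == k then Z @^-1` [set z] `&` E z else set0) else set0.
rewrite (_ : [set w | _] = \bigcup_k A k).
  apply: indep_future_bigcup => [i j _ _|k]; last first.
    rewrite /A; case: choice.unpickle => [z|]; last exact: indep_future_set0.
    by case: ifP => // _; exact: indep_future_set0.
  rewrite /A; case: choice.unpickle => [z|]; last by rewrite set0I => /set0P; rewrite eqxx.
  case: eqP => [zi|_]; last by rewrite set0I => /set0P; rewrite eqxx.
  case: choice.unpickle => [z'|]; last by rewrite setI0 => /set0P; rewrite eqxx.
  case: eqP => [z'j|_]; last by rewrite setI0 => /set0P; rewrite eqxx.
  by move=> [w [[/= wz _] [/= wz' _]]]; rewrite -zi -z'j -wz -wz'.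
apply/seteqP; split => [w Ew|w [k _]].
  by exists (choice.pickle (Z w)) => //; rewrite /A choice.pickleK eqxx.
by rewrite /A; case: choice.unpickle => // z; case: ifP => // _ [/= <-].
Qed.

(** A chain driven by independent inputs: its state at time [m] is determined by
    the inputs of index less than [m]. *)
Lemma indep_future_chain (S : countType) (Z : nat -> T -> S)
    (next : nat -> S -> T -> S) m0 z0 :
  indep_future m0 setT -> (forall w, Z m0 w = z0) ->
  (forall m w, (m0 <= m)%N -> Z m.+1 w = next m (Z m w) w) ->
  (forall m z, (m0 <= m)%N -> adapted (F m) (next m z)) ->
  forall m z, (m0 <= m)%N -> indep_future m (Z m @^-1` [set z]).
Proof.
move=> iT Z0 ZS nF m z /subnK <-; elim: (m - m0)%N z => [|k IH] z; rewrite ?addSn ?add0n.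
  have [->|zz] := eqVneq z z0.
    by rewrite (_ : _ @^-1` _ = setT) //; apply/seteqP; split => // w _; exact: Z0.
  rewrite (_ : _ @^-1` _ = set0); first exact: indep_future_set0.
  apply/seteqP; split => // w; rewrite /= Z0 => e.
  by rewrite e eqxx in zz.
rewrite (_ : _ @^-1` _ = [set w | (next (k + m0)%N (Z (k + m0)%N w) @^-1` [set z]) w]).
  apply: (@indep_future_partition _ _ (fun y => next (k + m0)%N y @^-1` [set z])) => y.
  by apply: indep_future_step => //; apply: nF; rewrite leq_addl.
by apply/seteqP; split => w /=; rewrite ZS // leq_addl.
Qed.

End FutureIndependence.

Section DiscreteIntegral.
Context d (T : measurableType d) (R : realType) (P : probability T R).
Local Open Scope ereal_scope.

Lemma integral_probability_cst (r : \bar R) : \int[P]_w (cst r w) = r.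
Proof. by rewrite integral_cst // -[RHS]mule1; congr (_ * _); exact: probability_setT. Qed.

Lemma integral_probability_indic (A : set T) : measurable A ->
  \int[P]_w (\1_A w)%:E = P A.
Proof. by move=> mA; rewrite integral_indic // setIT. Qed.

Definition discrete (G : set (set T)) (f : T -> \bar R) : Prop :=
  exists (U : T -> nat) (phi : nat -> \bar R), adapted G U /\ f = phi \o U.

Lemma discreteP (S : countType) (G : set (set T)) (U : T -> S) (phi : S -> \bar R) :
  adapted G U -> discrete G (fun w => phi (U w)).
Proof.
move=> GU; exists (choice.pickle \o U), (fun k => oapp phi 0 (choice.unpickle k)); split.
  exact: adapted_comp.
by apply/funext => w /=; rewrite choice.pickleK.
Qed.

Lemma adapted_measurable_fun d' (U : measurableType d') (Z : T -> U) D :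
  adapted measurable Z -> measurable_fun D Z.
Proof. by move=> mZ mD Y _; apply: measurableI => //; exact: mZ. Qed.

Lemma fibers_trivIset (Z : T -> nat) (A : set T) :
  trivIset setT (fun k => A `&` Z @^-1` [set k]).
Proof. by move=> i j _ _ [w [[_ /= <-] [_ /= <-]]]. Qed.

Lemma fibers_cover (Z : T -> nat) (A : set T) : A = \bigcup_k (A `&` Z @^-1` [set k]).
Proof. by apply/seteqP; split => [w Aw|w [k _ []]//]; exists (Z w). Qed.

Lemma integral_fibers (Z : T -> nat) (f : T -> \bar R) (A : set T) :
  adapted measurable Z -> measurable A -> measurable_fun A f ->
  (forall w, 0 <= f w) ->
  \int[P]_(w in A) f w = \sum_(0 <= k <oo) \int[P]_(w in A `&` Z @^-1` [set k]) f w.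
Proof.
move=> mZ mA mf f0; rewrite {1}(fibers_cover Z A) ge0_integral_bigcup //.
- by move=> k; apply: measurableI => //; exact: mZ.
- by rewrite -fibers_cover.
- exact: fibers_trivIset.
Qed.

Lemma integral_indep (G : set (set T)) (A : set T) (f : T -> \bar R) :
  G `<=` measurable -> measurable A ->
  (forall B, G B -> P (A `&` B) = P A * P B) ->
  discrete G f -> (forall w, 0 <= f w) ->
  \int[P]_(w in A) f w = P A * \int[P]_w f w.
Proof.
move=> Gm mA AB [U [phi [GU ->]]] f0.
have mU : adapted measurable U by move=> B; exact/Gm/GU.
have mf D : measurable_fun D (phi \o U).
  apply: adapted_measurable_fun; exact: adapted_comp.
rewrite (integral_fibers mU mA) // [in RHS](integral_fibers mU) //.
have e (D : set T) k : measurable D ->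
    \int[P]_(w in D `&` U @^-1` [set k]) (phi \o U) w = phi k * P (D `&` U @^-1` [set k]).
  move=> mD; rewrite -integral_cst; last by apply: measurableI => //; exact: mU.
  by apply: eq_integral => w; rewrite inE => -[_ /= ->].
have [c [c0 Ec]] : exists c : R, (0 <= c)%R /\ P A = c%:E.
  by exists (fine (P A)); rewrite fineK ?fin_num_measure // fine_ge0.
rewrite Ec -nneseriesZl; last by move=> k _; exact: integral_ge0.
apply: eq_eseriesr => k _; rewrite !e // setTI AB; last exact: GU.
by rewrite -Ec muleCA muleA.
Qed.

(** Fubini for two independent sources of randomness, the first of which takes
    countably many values. *)
Lemma integral_countable_indep (S : countType) (Z : T -> S) (G : set (set T))
    (h : S -> T -> \bar R) :
  adapted measurable Z -> G `<=` measurable ->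
  (forall z B, G B -> P (Z @^-1` [set z] `&` B) = P (Z @^-1` [set z]) * P B) ->
  (forall z, discrete G (h z)) -> (forall z w, 0 <= h z w) ->
  \int[P]_w h (Z w) w = \int[P]_w (\int[P]_w' h (Z w) w').
Proof.
move=> mZ Gm ZG hG h0.
pose Z' := choice.pickle \o Z.
have mZ' : adapted measurable Z' by exact: adapted_comp.
have mh z D : measurable_fun D (h z).
  have [U [phi [GU ->]]] := hG z; apply: adapted_measurable_fun.
  by apply: adapted_comp => B; exact/Gm/GU.
have mhZ : measurable_fun setT (fun w => h (Z w) w).
  apply: adapted_measurable_fun; apply: adapted_bind => //.
    exact: sigma_algebra_measurable.
  move=> z; have [U [phi [GU ->]]] := hG z.
  by apply: adapted_comp => B; exact/Gm/GU.
rewrite (integral_fibers mZ') // [in RHS](integral_fibers mZ') //; last 2 first.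
- apply: adapted_measurable_fun.
  exact: (adapted_comp (fun z => \int[P]_w' h z w')).
- by move=> w; exact: integral_ge0.
apply: eq_eseriesr => k _; rewrite setTI.
have [[w0 /= Zk]|no] := pselect (exists w, Z' w = k); last first.
  rewrite (_ : _ @^-1` _ = set0) ?integral_set0 //.
  by apply/seteqP; split => // w /= Zw; apply: no; exists w.
have inj w : Z' w = k -> Z w = Z w0.
  by rewrite -Zk => /(pcan_inj choice.pickleK).
have -> : Z' @^-1` [set k] = Z @^-1` [set Z w0].
  by apply/seteqP; split => w /= => [/inj//|Zw]; rewrite /Z' /= Zw.
transitivity (\int[P]_(w in Z @^-1` [set Z w0]) h (Z w0) w).
  by apply: eq_integral => w; rewrite inE /= => ->.
rewrite (integral_indep Gm) //; last by move=> B; exact: ZG.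
transitivity (\int[P]_(w in Z @^-1` [set Z w0]) (cst (\int[P]_w' h (Z w0) w')) w).
  by rewrite integral_cst; [rewrite muleC|exact: mZ].
by apply: eq_integral => w; rewrite inE /= => ->.
Qed.

End DiscreteIntegral.

(** * Gambler's ruin *)

(** The walk is shifted so that it starts at [c], with the far target at [0] and
    the near one at [c.+1]. *)
Definition inside (c j : nat) : bool := (0 < j <= c)%N.

Definition ruin_step (c : nat) (b : bool) (j : nat) : nat :=
  if inside c j then (if b then j.+1 else j.-1) else j.

Fixpoint ruin (c : nat) (b : nat -> bool) (m : nat) : nat :=
  if m is k.+1 then ruin_step c (b k) (ruin c b k) else c.

(** The value [0] when the walk never leaves the interval is harmless: this has
    probability zero ([never_ruined]). *)
Definition ruin_time (c : nat) (b : nat -> bool) : nat :=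
  if pselect (exists m, ~~ inside c (ruin c b m)) is left ex then ex_minn ex else 0%N.

Definition ruin_near (c : nat) (b : nat -> bool) : bool :=
  ruin c b (ruin_time c b) == c.+1.

Lemma ruin_le c b m : (ruin c b m <= c.+1)%N.
Proof.
elim: m => [|m IH] /=; first exact: leqnSn.
by rewrite /ruin_step /inside; case: ifP => // /andP[]; case: (b m); lia.
Qed.

Lemma ruin_stop c b m n : (m <= n)%N -> ~~ inside c (ruin c b m) ->
  ruin c b n = ruin c b m.
Proof.
move=> /subnK <- out; elim: (n - m)%N => [//|k IH].
by rewrite addSn /= IH /ruin_step (negbTE out).
Qed.

Lemma ruin_timeP c b m : ~~ inside c (ruin c b m) ->
  ~~ inside c (ruin c b (ruin_time c b)) /\
  forall i, (i < ruin_time c b)%N -> inside c (ruin c b i).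
Proof.
move=> out; rewrite /ruin_time; case: pselect => [ex|[]]; last by exists m.
case: ex_minnP => t outt tmin; split => // i; rewrite ltnNge.
by apply: contraR => /tmin.
Qed.

Lemma inside_lt_time c b m : (m < ruin_time c b)%N -> inside c (ruin c b m).
Proof.
rewrite /ruin_time; case: pselect => [ex|//]; case: ex_minnP => t _ tmin.
by rewrite ltnNge; apply: contraR => /tmin.
Qed.

Lemma inside_time_le c b m : ~~ inside c (ruin c b m) -> (ruin_time c b <= m)%N.
Proof. by move=> out; rewrite leqNgt; apply: contra out; exact: inside_lt_time. Qed.

Lemma mem_bool_set (T : Type) (A : pred T) (w : T) : (w \in [set x | A x]) = A w.
Proof. by apply/idP/idP; rewrite inE. Qed.

Section Indicators.
Variable R : realType.

Lemma nneseries_indic (f : nat -> R) (n : nat) : (forall m, 0 <= f m) ->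
  (\sum_(0 <= m <oo) (f m * (m < n)%:R)%:E = (\sum_(0 <= m < n) f m)%:E)%E.
Proof.
move=> f0; rewrite (nneseries_split _ n); last first.
  by move=> k _; rewrite lee_fin mulr_ge0.
rewrite add0n eseries0 ?adde0; last first.
  by move=> i ni _; rewrite ltnNge ni mulr0.
rewrite sumEFin; congr _%:E; apply: eq_big_nat => i /andP[_ ->].
by rewrite mulr1.
Qed.

End Indicators.

Section RuinAdapted.
Variables (T : Type) (G : set (set T)) (bit : nat -> T -> bool) (c : nat).
Hypothesis GS : sigma_algebra setT G.
Hypothesis Gbit : forall i, adapted G (bit i).

Lemma ruin_sigma m : adapted G (fun w => ruin c (bit^~ w) m).
Proof.
elim: m => [|m IH]; first exact: adapted_cst.
apply: (adapted_bind GS (f := fun j w => ruin_step c (bit m w) j)) => // j.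
exact: (adapted_comp (fun b => ruin_step c b j) (@Gbit m)).
Qed.

Lemma lt_ruin_timeE m : [set w | (m < ruin_time c (bit^~ w))%N] =
  [set w | inside c (ruin c (bit^~ w) m)] `&`
  \bigcup_n [set w | ~~ inside c (ruin c (bit^~ w) n)].
Proof.
apply/seteqP; split => [w /= mt|w [/= inm [n _ /= outn]]].
  split; first exact: inside_lt_time mt.
  move: mt; rewrite /ruin_time; case: pselect => // -[n outn] _.
  by exists n.
rewrite ltnNge; apply/negP => tm; have [out _] := ruin_timeP outn.
by rewrite (ruin_stop tm out) (negbTE out) in inm.
Qed.

Lemma lt_ruin_time_sigma m : G [set w | (m < ruin_time c (bit^~ w))%N].
Proof.
rewrite lt_ruin_timeE; apply: sigma_setI => //.
  exact: (@ruin_sigma m [set j | inside c j]).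
apply: sigma_bigcup => // n; exact: (@ruin_sigma n [set j | ~~ inside c j]).
Qed.

Lemma ruin_time_sigma : adapted G (fun w => ruin_time c (bit^~ w)).
Proof.
apply: adapted_fibers => // -[|t].
  rewrite (_ : _ @^-1` _ = ~` [set w | (0 < ruin_time c (bit^~ w))%N]).
    by apply: sigma_setC => //; exact: lt_ruin_time_sigma.
  by apply/seteqP; split => w /=; case: ruin_time.
rewrite (_ : _ @^-1` _ = [set w | (t < ruin_time c (bit^~ w))%N] `&`
    ~` [set w | (t.+1 < ruin_time c (bit^~ w))%N]).
  apply: sigma_setI => //; first exact: lt_ruin_time_sigma.
  by apply: sigma_setC => //; exact: lt_ruin_time_sigma.
apply/seteqP; split => w /= => [->|[]]; first by split => //; rewrite ltnn.
by move=> tt /negP; rewrite -leqNgt => ?; apply/eqP; rewrite eqn_leq; apply/andP.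
Qed.

Lemma ruin_near_sigma : adapted G (fun w => ruin_near c (bit^~ w)).
Proof.
apply: (@adapted_bind _ _ GS _ _ _ (fun t w => ruin c (bit^~ w) t == c.+1)).
  exact: ruin_time_sigma.
by move=> t; exact: (adapted_comp (fun j => j == c.+1) (@ruin_sigma t)).
Qed.

End RuinAdapted.

Section GamblersRuin.
Context d (T : measurableType d) (R : realType) (P : probability T R).
Variables (F : nat -> set (set T)) (bit : nat -> T -> bool) (c : nat).
Hypothesis F_measurable : forall i, F i `<=` measurable.
Hypothesis F_indep : mutually_independent P setT F.
Hypothesis bit_adapted : forall i, adapted (F i) (bit i).
Hypothesis bit_fair : forall i, P (bit i @^-1` [set true]) = (2^-1)%:E.
Hypothesis c_gt0 : (0 < c)%N.

Let Z (m : nat) (w : T) : nat := ruin c (bit^~ w) m.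

Lemma ruin_future m j : indep_future P F m (Z m @^-1` [set j]).
Proof.
apply: (@indep_future_chain _ _ _ P F F_measurable _ Z
  (fun m z w => ruin_step c (bit m w) z) 0%N c) => //.
- exact: indep_future_setT F_indep _.
- by move=> i z _ B; exact: (@bit_adapted i [set b | B (ruin_step c b z)]).
Qed.

Lemma ruin_adapted m : adapted measurable (Z m).
Proof.
apply: adapted_fibers; first exact: sigma_algebra_measurable.
by move=> j; case: (ruin_future m j).
Qed.

Lemma bit_integral i (f : bool -> R) : (forall b, 0 <= f b) ->
  (\int[P]_w (f (bit i w))%:E = ((f true + f false) / 2)%:E)%E.
Proof.
move=> f0.
have mb : adapted measurable (bit i) by move=> B; exact/(@F_measurable i)/bit_adapted.
have mI b : measurable (bit i @^-1` [set b]) by exact: mb.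
have -> : (fun w => (f (bit i w))%:E) = (fun w =>
    (f true)%:E * (\1_(bit i @^-1` [set true]) w)%:E +
    (f false)%:E * (\1_(bit i @^-1` [set false]) w)%:E)%E.
  apply/funext => w; rewrite !indicE.
  have ib b : (w \in bit i @^-1` [set b]) = (bit i w == b).
    by apply/idP/eqP; rewrite inE.
  by rewrite !ib; case: (bit i w); rewrite ?mule1 ?mule0 ?adde0 ?add0e.
have mi b : measurable_fun setT (fun w => (\1_(bit i @^-1` [set b]) w)%:E : \bar R).
  by apply/measurable_EFinP; exact: measurable_indic.
rewrite ge0_integralD //=; last 4 first.
- by move=> w _; rewrite mule_ge0 ?lee_fin.
- by apply: measurable_funeM.
- by move=> w _; rewrite mule_ge0 ?lee_fin.
- by apply: measurable_funeM.
rewrite !ge0_integralZl ?lee_fin //.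
have bit_unfair : P (bit i @^-1` [set false]) = (2^-1)%:E.
  have -> : bit i @^-1` [set false] = ~` (bit i @^-1` [set true]).
    by apply/seteqP; split => w /=; case: (bit i w).
  by rewrite probability_setC // bit_fair -EFinB; congr _%:E; field.
transitivity ((f true)%:E * (2^-1)%:E + (f false)%:E * (2^-1)%:E : \bar R)%E.
  rewrite !integral_probability_indic //; congr (_ * _ + _ * _)%E; first exact: bit_fair.
  exact: bit_unfair.
by rewrite -!EFinM -EFinD; congr _%:E; field.
Qed.

Definition ruin_mean (m : nat) (h : nat -> R) : R := fine (\int[P]_w (h (Z m w))%:E)%E.

Lemma measurable_ruin m (h : nat -> R) :
  measurable_fun setT (fun w => (h (Z m w))%:E : \bar R).
Proof.
by apply: adapted_measurable_fun; exact: (adapted_comp (fun j => (h j)%:E) (ruin_adapted m)).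
Qed.

Lemma ruin_meanE m (h : nat -> R) : (forall j, 0 <= h j) ->
  (\int[P]_w (h (Z m w))%:E = (ruin_mean m h)%:E)%E.
Proof.
move=> h0; rewrite fineK // ge0_fin_numE; last first.
  by apply: integral_ge0 => w _; rewrite lee_fin.
apply: (@le_lt_trans _ _ (\int[P]_w (cst (\sum_(0 <= j < c.+2) h j)%:E) w)%E); last first.
  by rewrite integral_probability_cst ltry.
apply: ge0_le_integral => //.
- by move=> w _; rewrite lee_fin.
- exact: measurable_ruin.
- move=> w _; rewrite lee_fin (big_cat_nat (n := Z m w)) //=; last first.
    by rewrite ltnW // ltnS ruin_le.
  rewrite (big_ltn (m := Z m w)) ?ltnS ?ruin_le //.
  by rewrite addrCA lerDl addr_ge0 ?sumr_ge0.
Qed.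

Lemma ruin_meanS m (h : nat -> R) : (forall j, 0 <= h j) ->
  ruin_mean m.+1 h =
  ruin_mean m (fun j => if inside c j then (h j.+1 + h j.-1) / 2 else h j).
Proof.
move=> h0; rewrite /ruin_mean; congr fine.
rewrite (integral_countable_indep (Z := Z m)
   (h := fun j w => (h (ruin_step c (bit m w) j))%:E) (G := F m)) //.
- apply: eq_integral => w _; rewrite (@bit_integral m (fun b => h (ruin_step c b (Z m w)))) //.
  by rewrite /ruin_step; case: ifP => // _; congr _%:E; field.
- exact: ruin_adapted.
- by move=> z B FB; exact: indep_futureI (ruin_future _ _) FB.
- by move=> z; exact: (discreteP (fun b => (h (ruin_step c b z))%:E) (@bit_adapted m)).
- by move=> z w; rewrite lee_fin.
Qed.

Lemma ruin_mean0 (h : nat -> R) : ruin_mean 0 h = h c.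
Proof. by rewrite /ruin_mean (integral_probability_cst P (h c)%:E). Qed.

Lemma ruin_mean_linear m a (f : nat -> R) b (h : nat -> R) :
  0 <= a -> 0 <= b -> (forall j, 0 <= f j) -> (forall j, 0 <= h j) ->
  ruin_mean m (fun j => a * f j + b * h j) = a * ruin_mean m f + b * ruin_mean m h.
Proof.
move=> a0 b0 f0 h0; apply: EFin_inj.
rewrite -ruin_meanE; last by move=> j; rewrite addr_ge0 ?mulr_ge0.
under eq_integral do rewrite EFinD !EFinM.
rewrite ge0_integralD //; last 4 first.
- by move=> w _; rewrite mule_ge0 ?lee_fin.
- by apply: measurable_funeM; exact: measurable_ruin.
- by move=> w _; rewrite mule_ge0 ?lee_fin.
- by apply: measurable_funeM; exact: measurable_ruin.
rewrite !ge0_integralZl ?lee_fin // ?ruin_meanE //.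
- exact: measurable_ruin.
- by move=> w _; rewrite lee_fin.
- exact: measurable_ruin.
- by move=> w _; rewrite lee_fin.
Qed.

Lemma ruin_meanZ m a (f : nat -> R) : 0 <= a -> (forall j, 0 <= f j) ->
  ruin_mean m (fun j => a * f j) = a * ruin_mean m f.
Proof.
move=> a0 f0; have := ruin_mean_linear m a0 (lexx 0) f0 (fun j => lexx (0 : R)).
rewrite [0 * ruin_mean _ _]mul0r addr0 => <-; congr (ruin_mean m _).
by apply/funext => j; rewrite mul0r addr0.
Qed.

Lemma ruin_mean_le m (f h : nat -> R) : (forall j, 0 <= f j) ->
  (forall j, (j <= c.+1)%N -> f j <= h j) -> ruin_mean m f <= ruin_mean m h.
Proof.
move=> f0 fh.
pose h' j := if (j <= c.+1)%N then h j else f j.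
have fh' j : f j <= h' j by rewrite /h'; case: ifP => // /fh.
have h'0 j : 0 <= h' j by rewrite (le_trans (f0 j)).
have -> : ruin_mean m h = ruin_mean m h'.
  rewrite /ruin_mean; congr fine; apply: eq_integral => w _.
  by rewrite /h' ruin_le.
rewrite -lee_fin -!ruin_meanE //; apply: ge0_le_integral => //.
- by move=> w _; rewrite lee_fin.
- exact: measurable_ruin.
- exact: measurable_ruin.
- by move=> w _; rewrite lee_fin.
Qed.

Lemma ruin_mean_ge0 m (h : nat -> R) : (forall j, 0 <= h j) -> 0 <= ruin_mean m h.
Proof.
by move=> h0; rewrite -lee_fin -ruin_meanE //; apply: integral_ge0 => w _; rewrite lee_fin.
Qed.

Lemma ruin_mean_indic m (A : pred nat) :
  (ruin_mean m (fun j => (A j)%:R))%:E = P [set w | A (Z m w)].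
Proof.
rewrite -ruin_meanE // -integral_probability_indic; last first.
  exact: (@ruin_adapted m [set j | A j]).
by apply: eq_integral => w _; rewrite indicE mem_bool_set.
Qed.

Let p (m : nat) : R := ruin_mean m (fun j => (inside c j)%:R).
Let q (m : nat) : R := ruin_mean m (fun j => (j * (c.+1 - j))%:R).
Let K : R := c.+1%:R ^+ 2 * c%:R.

(** The function [j * (c + 1 - j)] decreases on average by one per step spent
    inside, so its mean counts the expected steps still to come. *)
Lemma quadratic_step m : q m = q m.+1 + p m.
Proof.
rewrite /q ruin_meanS // -[X in _ = X]mulr1 mulrDl ![_ * 1]mulrC /p.
rewrite -ruin_mean_linear //; last by move=> j; case: ifP => // _; rewrite divr_ge0.
rewrite /ruin_mean; congr fine; apply: eq_integral => w _; congr _%:E.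
rewrite !mul1r; case: ifP => [/andP[]|_]; last by rewrite addr0.
case: (Z m w) => // j _ jc; rewrite succnK.
have [e1 [e2 e3]] : (c.+1 - j.+1 = c - j)%N /\ (c.+1 - j.+2 = c - j.+1)%N /\
   (c.+1 - j = (c - j).+1)%N by lia.
rewrite e1 e2 e3; have -> : (c - j = (c - j.+1).+1)%N by lia.
by move: (c - j.+1)%N => k; rewrite -!natrD !natrM -!natr1; field.
Qed.

Lemma survival_sum N : \sum_(0 <= i < N) p i = c%:R - q N.
Proof.
elim: N => [|N IH].
  by rewrite big_geq // /q ruin_mean0 subSnn muln1 subrr.
by rewrite big_nat_recr //= IH (quadratic_step N); ring.
Qed.

Lemma quadratic_mean_ge0 m : 0 <= q m. Proof. exact: ruin_mean_ge0. Qed.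
Lemma survival_ge0 m : 0 <= p m. Proof. exact: ruin_mean_ge0. Qed.

Lemma quadratic_mean_le m : q m <= c.+1%:R ^+ 2 * p m.
Proof.
rewrite -ruin_meanZ ?exprn_ge0 //.
apply: ruin_mean_le => // j jc; rewrite -natrX -natrM ler_nat.
rewrite /inside; have [h|h] := leqP j c.
  case: j jc h => // j jc h /=; rewrite muln1 -mulnn leq_mul ?leq_subr //.
by rewrite (_ : (c.+1 - j)%N = 0%N) ?muln0 //; apply/eqP; rewrite subn_eq0.
Qed.

(** Summation by parts in [survival_sum]. It bounds the second moment of the exit
    time, and it shows that survival up to time [N] has probability [O(1 / N)]. *)
Lemma weighted_survival_sum N : \sum_(0 <= i < N) i.+1%:R * p i <= K.
Proof.
have -> : \sum_(0 <= i < N) i.+1%:R * p i = \sum_(0 <= i < N) q i - N%:R * q N.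
  elim: N => [|N IH]; first by rewrite !big_geq // mul0r subrr.
  rewrite !big_nat_recr //= IH -[N.+1%:R]natr1 (quadratic_step N); ring.
apply: (@le_trans _ _ (\sum_(0 <= i < N) c.+1%:R ^+ 2 * p i)).
  rewrite lerBlDr (le_trans (ler_sum _ (fun i _ => quadratic_mean_le i))) // lerDl.
  by rewrite mulr_ge0 // quadratic_mean_ge0.
by rewrite -mulr_sumr survival_sum ler_wpM2l ?exprn_ge0 // gerBl quadratic_mean_ge0.
Qed.

(** The last term of the preceding sum. *)
Lemma survival_le N : p N <= K / N.+1%:R.
Proof.
rewrite ler_pdivlMr ?ltr0n // mulrC; apply: le_trans (weighted_survival_sum N.+1).
rewrite big_nat_recr //= lerDr sumr_ge0 // => i _.
by rewrite mulr_ge0 // survival_ge0.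
Qed.

Lemma archimedean_div_lt (e A : R) : 0 < e -> exists N : nat, A / N.+1%:R < e.
Proof.
move=> e0; exists (Num.truncn (A / e)); rewrite ltr_pdivrMr ?ltr0n //.
by rewrite mulrC -ltr_pdivrMr // truncnS_gt.
Qed.

Let time (w : T) : nat := ruin_time c (bit^~ w).
Let near (w : T) : bool := ruin_near c (bit^~ w).

Let mbit i : adapted measurable (bit i).
Proof. by move=> B; exact/(@F_measurable i)/bit_adapted. Qed.

Lemma never_measurable : measurable [set w | forall m, inside c (Z m w)].
Proof.
rewrite (_ : [set w | _] = \bigcap_m [set w | inside c (Z m w)]).
  apply: (sigma_bigcap (sigma_algebra_measurable T)) => m.
  exact: (@ruin_adapted m [set j | inside c j]).
by apply/seteqP; split => w /= h m; [move=> _; exact: h|exact: (h m I)].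
Qed.

Lemma never_ruined : P [set w | forall m, inside c (Z m w)] = 0%E.
Proof.
have mN := never_measurable.
apply/eqP; rewrite eq_le measure_ge0 andbT; apply/lee_addgt0Pr => e e0.
have [N /ltW KN] := archimedean_div_lt K e0; rewrite add0e.
apply: (@le_trans _ _ (p N)%:E); last by rewrite lee_fin (le_trans (survival_le N)).
rewrite /p (ruin_mean_indic N (inside c)); apply: le_measure; rewrite ?inE //.
- exact: (@ruin_adapted N [set j | inside c j]).
- by move=> w; exact.
Qed.

Lemma lt_time_prob m : P [set w | (m < time w)%N] = (p m)%:E.
Proof.
have mt : measurable [set w | (m < time w)%N].
  exact: (lt_ruin_time_sigma c (sigma_algebra_measurable T) mbit).
have mi : measurable [set w | inside c (Z m w)].
  exact: (@ruin_adapted m [set j | inside c j]).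
have mN := never_measurable.
rewrite /p (ruin_mean_indic m (inside c)); apply/eqP; rewrite eq_le; apply/andP; split.
  by apply: le_measure; rewrite ?inE // => w /inside_lt_time.
rewrite -[leRHS]adde0 -never_ruined.
have := measureU2 P mt mN; apply: le_trans; apply: le_measure; rewrite ?inE //.
  exact: measurableU.
move=> w /= inm; have [all|] := pselect (forall n, inside c (Z n w)); first by right.
move=> /existsNP[n /negP out]; left.
have : [set w | (m < ruin_time c (bit^~ w))%N] w by rewrite lt_ruin_timeE; split => //; exists n.
by [].
Qed.

Let mtime : adapted measurable time.
Proof. exact: (ruin_time_sigma c (sigma_algebra_measurable T) mbit). Qed.

Lemma time_integral (f : nat -> R) : (forall m, 0 <= f m) ->
  (\int[P]_w (\sum_(0 <= m < time w) f m)%:E = \sum_(0 <= m <oo) (f m * p m)%:E)%E.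
Proof.
move=> f0.
under eq_integral do rewrite -nneseries_indic //.
have mi m : measurable_fun setT (fun w => ((f m * (m < time w)%:R)%:E : \bar R)).
  apply: adapted_measurable_fun.
  exact: (adapted_comp (fun n => (f m * (m < n)%:R)%:E) mtime).
rewrite integral_nneseries //; last by move=> m w _; rewrite lee_fin mulr_ge0.
apply: eq_eseriesr => m _; rewrite EFinM -lt_time_prob.
have mt : measurable [set w | (m < time w)%N] by exact: (@mtime [set n | (m < n)%N]).
rewrite -(integral_probability_indic P mt) -ge0_integralZl ?lee_fin //.
  by apply: eq_integral => w _; rewrite indicE EFinM mem_bool_set.
by apply/measurable_EFinP; exact: measurable_indic.
Qed.

Lemma ruin_time_mean : (\int[P]_w ((time w)%:R)%:E = (c%:R)%:E)%E.
Proof.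
transitivity (\int[P]_w (\sum_(0 <= m < time w) (1:R))%:E)%E.
  by apply: eq_integral => w _; rewrite sumr_const_nat subn0.
rewrite time_integral //; under eq_eseriesr do rewrite mul1r.
have sumE N : (\sum_(0 <= i < N) (p i)%:E = (c%:R - q N)%:E)%E.
  by rewrite sumEFin survival_sum.
apply/eqP; rewrite eq_le; apply/andP; split.
  apply: lime_le; first by apply: is_cvg_nneseries => m _ _; rewrite lee_fin survival_ge0.
  by apply: nearW => N; rewrite sumE lee_fin gerBl quadratic_mean_ge0.
apply/lee_addgt0Pr => e e0.
have [N /ltW KN] := archimedean_div_lt (c.+1%:R ^+ 2 * K) e0.
apply: (@le_trans _ _ ((c%:R - q N)%:E + e%:E)%E).
  have qe : q N <= e.
    apply: (le_trans (quadratic_mean_le N)); apply: (le_trans _ KN); rewrite -mulrA.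
    by rewrite ler_wpM2l ?exprn_ge0 // survival_le.
  by rewrite -EFinD lee_fin; move: qe; lra.
rewrite leeD2r // -sumE; apply: nneseries_lim_ge => m _ _.
by rewrite lee_fin survival_ge0.
Qed.

Lemma ruin_time_square : (\int[P]_w ((time w)%:R ^+ 2)%:E <= (2 * K)%:E)%E.
Proof.
apply: (@le_trans _ _ (\int[P]_w (\sum_(0 <= m < time w) (2 * m.+1%:R : R))%:E)%E).
  apply: ge0_le_integral => //.
  - apply: adapted_measurable_fun.
    exact: (adapted_comp (fun n => ((n%:R ^+ 2)%:E : \bar R)) mtime).
  - apply: adapted_measurable_fun.
    exact: (adapted_comp (fun n => ((\sum_(0 <= m < n) (2 * m.+1%:R : R))%:E : \bar R)) mtime).
  - move=> w _; rewrite lee_fin; elim: (time w) => [|n IH].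
      by rewrite big_geq // expr0n.
    rewrite big_nat_recr //=; apply: le_trans (lerD IH (lexx _)).
    by rewrite -[n.+1%:R]natr1; have : 0 <= n%:R :> R by []; nra.
rewrite time_integral //.
apply: lime_le.
  by apply: is_cvg_nneseries => m _ _; rewrite lee_fin !mulr_ge0 // survival_ge0.
apply: nearW => N; rewrite sumEFin lee_fin.
under eq_bigr do rewrite -mulrA.
by rewrite -mulr_sumr ler_wpM2l // weighted_survival_sum.
Qed.

Lemma linear_mean m : ruin_mean m (fun j => j%:R) = c%:R.
Proof.
elim: m => [|m IH]; first by rewrite ruin_mean0.
rewrite ruin_meanS // -{}IH /ruin_mean; congr fine; apply: eq_integral => w _.
congr _%:E; case: ifP => // /andP[]; case: (Z m w) => // j _ _ /=.
by rewrite -!natr1; field.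
Qed.

(** The position is a martingale, so the two exit probabilities are inversely
    proportional to the distances; the walks still inside contribute at most their
    probability. *)
Lemma ruin_near_prob : P [set w | near w] = (c%:R / c.+1%:R)%:E.
Proof.
have mnear : measurable [set w | near w].
  exact: (ruin_near_sigma c (sigma_algebra_measurable T) mbit [set b | b]).
pose r m := ruin_mean m (fun j => (j == c.+1)%:R).
have rE m : (r m)%:E = P [set w | Z m w == c.+1].
  by rewrite /r (ruin_mean_indic m (eq_op^~ c.+1)).
have mr m : measurable [set w | Z m w == c.+1].
  exact: (@ruin_adapted m [set j | j == c.+1]).
have r1 m : (P [set w | near w] <= (r m + p m)%:E)%E.
  rewrite EFinD rE /p (ruin_mean_indic m (inside c)).
  have mi : measurable [set w | inside c (Z m w)].
    exact: (@ruin_adapted m [set j | inside c j]).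
  have := measureU2 P (mr m) mi; apply: le_trans; apply: le_measure; rewrite ?inE //.
    exact: measurableU.
  move=> w /= nw; have [inm|outm] := boolP (inside c (Z m w)); first by right.
  left; have [out _] := ruin_timeP outm.
  by rewrite /= /Z (ruin_stop (inside_time_le outm) out).
have r2 m : ((r m)%:E <= P [set w | near w])%E.
  rewrite rE; apply: le_measure; rewrite ?inE // => w /= Zw.
  have outm : ~~ inside c (Z m w) by rewrite (eqP Zw) /inside ltnn andbF.
  have [out _] := ruin_timeP outm.
  by rewrite /near /ruin_near -(ruin_stop (inside_time_le outm) out).
have r3 m : c.+1%:R * r m <= c%:R <= c.+1%:R * r m + c.+1%:R * p m.
  rewrite -(linear_mean m); apply/andP; split.
    rewrite -ruin_meanZ //; apply: ruin_mean_le => j; first by rewrite mulr_ge0.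
    by case: eqP => [->|_]; rewrite ?mulr1 ?mulr0.
  rewrite -ruin_mean_linear //; apply: ruin_mean_le => // j jc.
  rewrite -!natrM -natrD ler_nat /inside; case: j jc => // j jc.
  by rewrite ltn0Sn /=; case: ltngtP jc => //= *; nia.
apply/eqP; rewrite eq_le; apply/andP; split; apply/lee_addgt0Pr => e e0.
- have [N /ltW KN] := archimedean_div_lt K e0.
  apply: (le_trans (r1 N)); rewrite -EFinD lee_fin lerD //.
    by rewrite ler_pdivlMr ?ltr0n // mulrC; case/andP: (r3 N).
  exact: le_trans (survival_le N) KN.
- have [N /ltW KN] := archimedean_div_lt K e0.
  apply: (@le_trans _ _ ((r N)%:E + e%:E)%E); last by rewrite leeD2r.
  rewrite -EFinD lee_fin ler_pdivrMr ?ltr0n // mulrC.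
  case/andP: (r3 N) => _ /le_trans; apply; rewrite mulrDr lerD2l ler_wpM2l //.
  exact: le_trans (survival_le N) KN.
Qed.

Lemma near_integral (f : bool -> R) : (forall b, 0 <= f b) ->
  (\int[P]_w (f (near w))%:E = ((c%:R * f true + f false) / c.+1%:R)%:E)%E.
Proof.
move=> f0.
have mnear : adapted measurable near.
  exact: (ruin_near_sigma c (sigma_algebra_measurable T) mbit).
have mI b : measurable [set w | near w == b] by exact: (@mnear [set x | x == b]).
have -> : (fun w => (f (near w))%:E) = (fun w =>
    (f true)%:E * (\1_[set w | near w == true] w)%:E +
    (f false)%:E * (\1_[set w | near w == false] w)%:E)%E.
  apply/funext => w; rewrite !indicE !mem_bool_set.
  by case: (near w); rewrite ?mule1 ?mule0 ?adde0 ?add0e.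
have mi b : measurable_fun setT (fun w => (\1_[set w | near w == b] w)%:E : \bar R).
  by apply/measurable_EFinP; exact: measurable_indic.
rewrite ge0_integralD //=; last 4 first.
- by move=> w _; rewrite mule_ge0 ?lee_fin.
- by apply: measurable_funeM.
- by move=> w _; rewrite mule_ge0 ?lee_fin.
- by apply: measurable_funeM.
rewrite !ge0_integralZl ?lee_fin //.
have c1 : c.+1%:R != 0 :> R by rewrite pnatr_eq0.
have pt : P [set w | near w == true] = (c%:R / c.+1%:R)%:E.
  rewrite -ruin_near_prob; congr (P _).
  by apply/seteqP; split => w /=; case: (near w).
have pf : P [set w | near w == false] = (1 - c%:R / c.+1%:R)%:E.
  have -> : [set w | near w == false] = ~` [set w | near w == true].
    by apply/seteqP; split => w /=; case: (near w).
  by rewrite probability_setC // pt -EFinB.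
transitivity ((f true)%:E * (c%:R / c.+1%:R)%:E +
    (f false)%:E * (1 - c%:R / c.+1%:R)%:E : \bar R)%E.
  by rewrite !integral_probability_indic //; congr (_ * _ + _ * _)%E.
rewrite -!EFinM -EFinD; congr _%:E; move: c1; rewrite -!natr1 => c1.
by field.
Qed.

(** A centred increment adds to a square only its own second moment. The increment
    is the exit time plus a term that depends on the exit side. *)
Lemma ruin_shifted_square (a : R) (f : bool -> R) :
  (c%:R * f true + f false) / c.+1%:R = - c%:R ->
  (\int[P]_w ((a + ((time w)%:R + f (near w))) ^+ 2)%:E <=
   (a ^+ 2 + 2 * (2 * K + (c%:R * f true ^+ 2 + f false ^+ 2) / c.+1%:R))%:E)%E.
Proof.
move=> fc.
have mnear : adapted measurable near.
  exact: (ruin_near_sigma c (sigma_algebra_measurable T) mbit).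
have mx : adapted measurable (fun w => (time w, near w)).
  apply: (@adapted_bind _ _ (sigma_algebra_measurable T) _ _ _ (fun t w => (t, near w)) mtime).
  by move=> t; exact: (adapted_comp (pair t) mnear).
pose X w : R := (time w)%:R + f (near w).
have mX (h : R -> R) : measurable_fun setT (fun w => (h (X w))%:E : \bar R).
  apply: adapted_measurable_fun.
  exact: (adapted_comp (fun y => (h (y.1%:R + f y.2))%:E : \bar R) mx).
have mt2 : measurable_fun setT (fun w => ((time w)%:R ^+ 2)%:E : \bar R).
  by apply: adapted_measurable_fun;
     exact: (adapted_comp (fun n => ((n%:R ^+ 2)%:E : \bar R)) mtime).
have mf2 : measurable_fun setT (fun w => (f (near w) ^+ 2)%:E : \bar R).
  by apply: adapted_measurable_fun;
     exact: (adapted_comp (fun b => ((f b ^+ 2)%:E : \bar R)) mnear).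
set V := 2 * K + _.
have X2 : (\int[P]_w (X w ^+ 2)%:E <= (2 * V)%:E)%E.
  apply: (@le_trans _ _ (\int[P]_w (2%:E * (((time w)%:R ^+ 2)%:E + (f (near w) ^+ 2)%:E)))%E).
    apply: ge0_le_integral => //.
    - by move=> w _; rewrite lee_fin sqr_ge0.
    - exact: (mX (fun x => x ^+ 2)).
    - by apply: measurable_funeM; exact: emeasurable_funD.
    - move=> w _; rewrite -EFinD -EFinM lee_fin /X.
      by have := sqr_ge0 ((time w)%:R - f (near w)); lra.
  rewrite ge0_integralZl //; last 2 first.
  - exact: emeasurable_funD.
  - by move=> w _; rewrite -EFinD lee_fin addr_ge0 ?sqr_ge0.
  rewrite EFinM lee_wpmul2l ?lee_fin // ge0_integralD //; last first.
    by move=> w _; rewrite lee_fin sqr_ge0.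
  rewrite (near_integral (f := fun b => f b ^+ 2)) => [|b]; last exact: sqr_ge0.
  by rewrite /V EFinD leeD2r // ruin_time_square.
have iX2 : P.-integrable setT (fun w => (X w ^+ 2)%:E).
  apply/integrableP; split; first exact: (mX (fun x => x ^+ 2)).
  under eq_integral do rewrite gee0_abs ?lee_fin ?sqr_ge0 //.
  exact: le_lt_trans X2 (ltry _).
have it : P.-integrable setT (fun w => ((time w)%:R)%:E : \bar R).
  apply/integrableP; split.
    by apply: adapted_measurable_fun; exact: (adapted_comp (fun n => (n%:R)%:E : \bar R) mtime).
  under eq_integral do rewrite gee0_abs ?lee_fin //.
  by rewrite ruin_time_mean ltry.
(* Shifting by [B] makes the integrand nonnegative. *)
have [B fB] : exists B, forall b, 0 <= f b + B.
  exists (`|f true| + `|f false|) => b.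
  have := normr_ge0 (f true); have := normr_ge0 (f false).
  by case: b; [have := ler_norm (- f true)|have := ler_norm (- f false)];
    rewrite normrN; lra.
have nb : (\int[P]_w (f (near w) + B)%:E = (B - c%:R)%:E)%E.
  rewrite (near_integral (f := fun b => f b + B)) //; congr _%:E.
  have c1 : c.+1%:R != 0 :> R by rewrite pnatr_eq0.
  by rewrite -fc; move: c1; rewrite -natr1 => c1; field.
have inb : P.-integrable setT (fun w => (f (near w) + B)%:E : \bar R).
  apply/integrableP; split.
    by apply: adapted_measurable_fun; exact: (adapted_comp (fun b => (f b + B)%:E : \bar R) mnear).
  under eq_integral do rewrite gee0_abs ?lee_fin //.
  by rewrite nb ltry.
have ic (r : R) : P.-integrable setT (fun=> r%:E : \bar R).
  exact: finite_measure_integrable_cst.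
have -> : (fun w => ((a + X w) ^+ 2)%:E) = (fun w =>
   (X w ^+ 2)%:E + ((2 * a)%:E * ((time w)%:R)%:E +
     ((2 * a)%:E * (f (near w) + B)%:E + (a ^+ 2 - 2 * a * B)%:E)))%E.
  by apply/funext => w; rewrite -!EFinM -!EFinD /X; congr _%:E; ring.
have i1 : P.-integrable setT (fun w => (2 * a)%:E * ((time w)%:R)%:E)%E.
  exact: integrableZl.
have i2 : P.-integrable setT (fun w => (2 * a)%:E * (f (near w) + B)%:E)%E.
  exact: integrableZl.
rewrite integralD //; last by apply: integrableD => //; exact: integrableD.
rewrite integralD //; last exact: integrableD.
rewrite integralD // integral_probability_cst !integralZl // nb ruin_time_mean.
apply: le_trans (leeD2r _ X2) _; rewrite -!EFinM -!EFinD lee_fin.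
by lra.
Qed.

End GamblersRuin.

(** * The joint chain *)

Section Chain.
Variable T : Type.
Variable Y : nat -> nat -> T -> int.

(** Sides are coded by booleans, the positive half-line by [true]. A step that is
    not upwards counts as downwards, so that steps are fair bits everywhere. *)
Definition toward (e : bool) (n i : nat) (w : T) : bool :=
  (Y n i.+1 w - Y n i w == 1) == e.

Definition settle_time (s : seq nat) (e : bool) (n : nat) (w : T) : nat :=
  ruin_time (gap (top s)) (fun i => toward e n i w).

Definition settle_near (s : seq nat) (e : bool) (n : nat) (w : T) : bool :=
  ruin_near (gap (top s)) (fun i => toward e n i w).

Definition new_stack (s : seq nat) (near : bool) : seq nat :=
  if near then retreat s else advance s.

(** A state consists of the stack, the side on which the last particle settled
    and the number of steps made so far. *)
Definition state : Type := (seq nat * bool * nat)%type.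

Definition next_state (n : nat) (z : state) (w : T) : state :=
  let near := settle_near z.1.1 z.1.2 n w in
  (new_stack z.1.1 near, near == z.1.2, (z.2 + settle_time z.1.1 z.1.2 n w)%N).

Fixpoint chain (n : nat) (w : T) : state :=
  if n is m.+1 then next_state n (chain m w) w else ([:: 0%N], true, 0%N).

Lemma stack_new s near : stack s -> stack (new_stack s near).
Proof. by move=> ss; case: near; [exact: stack_retreat|exact: stack_advance]. Qed.

Lemma stack_chain n w : stack (chain n w).1.1.
Proof. by elim: n => // n IH; exact: stack_new. Qed.

End Chain.

Section ChainLaw.
Context d (T : measurableType d) (R : realType) (P : probability T R).
Variable Y : nat -> nat -> T -> int.
Hypothesis Y_walk : forall n, (1 <= n)%N -> simple_symmetric_random_walk P (Y n).
Hypothesis Y_indep : mutually_independent P [set n : nat | (1 <= n)%N]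
                       (fun n => sigma_process (Y n)).

(** Particles are numbered from 1; the family is empty at 0, where nothing is known
    about the walk. *)
Definition inputs (n : nat) : set (set T) :=
  [set A | (1 <= n)%N /\ sigma_process (Y n) A].

Lemma inputs_measurable n : inputs n `<=` measurable.
Proof.
move=> A [n1]; apply: (smallest_sub (sigma_algebra_measurable T)) => B [i _].
by have [mY _ _ _] := Y_walk n1; exact: mY.
Qed.

Lemma inputs_indep : mutually_independent P [set n : nat | (1 <= n)%N] inputs.
Proof. by move=> J JD E JE; apply: Y_indep => // i /JE[]. Qed.

Lemma position_adapted n i : adapted (sigma_process (Y n)) (Y n i).
Proof. by move=> B; apply: sub_sigma_algebra; exists i => //; exists B. Qed.

Lemma step_adapted (G : set (set T)) n i : sigma_algebra setT G ->
  (forall i, adapted G (Y n i)) -> adapted G (fun w => Y n i.+1 w - Y n i w).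
Proof.
move=> GS GY.
apply: (@adapted_bind _ _ GS _ _ (Y n i) (fun z w => Y n i.+1 w - z)) => // z.
exact: (adapted_comp (fun y => y - z) (GY i.+1)).
Qed.

Lemma toward_adapted e n i : adapted (sigma_process (Y n)) (toward Y e n i).
Proof.
have := step_adapted i (smallest_sigma_algebra setT _) (@position_adapted n).
exact: (adapted_comp (fun z => (z == 1) == e)).
Qed.

Definition step_sigma (n i : nat) : set (set T) :=
  sigma_int (fun w => Y n i.+1 w - Y n i w).

Section OneWalk.
Variables (n : nat) (e : bool).
Hypothesis n1 : (1 <= n)%N.

Lemma step_sigma_measurable i : step_sigma n i `<=` measurable.
Proof.
move=> _ [B _ <-].
apply: (@step_adapted measurable n i (sigma_algebra_measurable T)) => j C.
by have [mY _ _ _] := Y_walk n1; apply: (mY j); exists C.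
Qed.

Lemma step_sigma_indep : mutually_independent P setT (step_sigma n).
Proof. by have [_ _ + _] := Y_walk n1. Qed.

Lemma toward_step_adapted i : adapted (step_sigma n i) (toward Y e n i).
Proof. by move=> B; exists [set z | B ((z == 1) == e)]. Qed.

Lemma toward_fair i : P (toward Y e n i @^-1` [set true]) = (2^-1)%:E.
Proof.
have [_ _ _ /(_ i)[Pup _]] := Y_walk n1.
have up : toward Y true n i @^-1` [set true] = [set w | Y n i.+1 w - Y n i w = 1].
  by rewrite /toward; apply/seteqP; split => w /=; [move=> /eqP h; apply/eqP|move=> ->].
case: e; first by rewrite up.
have -> : toward Y false n i @^-1` [set true] = ~` [set w | Y n i.+1 w - Y n i w = 1].
  rewrite /toward; apply/seteqP; split => w /=.
    by move=> /eqP h h1; rewrite h1 eqxx in h.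
  by move=> h; apply/eqP/negbTE/eqP.
rewrite probability_setC; last first.
  rewrite -up; apply: (@step_sigma_measurable i).
  by exists [set z | (z == 1) == true].
by rewrite Pup -EFinB; congr _%:E; field.
Qed.

End OneWalk.

Lemma settle_adapted s e n :
  adapted (sigma_process (Y n)) (fun w => (settle_near Y s e n w, settle_time Y s e n w)).
Proof.
have GS : sigma_algebra setT (sigma_process (Y n)) by exact: smallest_sigma_algebra.
have Gb := @toward_adapted e n.
apply: (@adapted_bind _ _ GS _ _ _ (fun b w => (b, settle_time Y s e n w))).
  exact: (ruin_near_sigma _ GS Gb).
move=> b; exact: (adapted_comp (pair b) (ruin_time_sigma _ GS Gb)).
Qed.

Lemma next_state_discrete (S : Type) n (z : state) (phi : state -> S) : (1 <= n)%N ->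
  adapted (inputs n) (fun w => phi (next_state Y n z w)).
Proof.
move=> n1 B; split => //; case: z => [[s e] v].
exact: (adapted_comp (fun o : bool * nat =>
  phi (new_stack s o.1, o.1 == e, (v + o.2)%N)) (@settle_adapted s e n)).
Qed.

Lemma chain_future m z : indep_future P inputs m.+1 (chain Y m @^-1` [set z]).
Proof.
apply: (@indep_future_chain _ _ _ P inputs inputs_measurable _
  (fun m => chain Y m.-1) (next_state Y) 1%N ([:: 0%N], true, 0%N)) => //.
- exact: indep_future_setT inputs_indep _.
- by case.
- by move=> n y n1; exact: (@next_state_discrete _ n y id n1).
Qed.

Lemma chain_adapted m : adapted measurable (chain Y m).
Proof.
apply: adapted_fibers; first exact: sigma_algebra_measurable.
by move=> z; case: (chain_future m z).
Qed.

Lemma chain_integral n (h : state -> R) : (forall z, 0 <= h z) ->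
  (\int[P]_w (h (chain Y n.+1 w))%:E =
   \int[P]_w (\int[P]_w' (h (next_state Y n.+1 (chain Y n w) w'))%:E))%E.
Proof.
move=> h0.
rewrite (integral_countable_indep (Z := chain Y n) (G := inputs n.+1)
  (h := fun z w => (h (next_state Y n.+1 z w))%:E)) //.
- exact: chain_adapted.
- exact: inputs_measurable.
- by move=> z B iB; exact: indep_futureI (chain_future n z) iB.
- move=> z; have := @next_state_discrete _ n.+1 z id isT.
  exact: (discreteP (fun z => (h z)%:E)).
- by move=> z w; rewrite lee_fin.
Qed.

Lemma measurable_chain n (h : state -> R) :
  measurable_fun setT (fun w => (h (chain Y n w))%:E : \bar R).
Proof.
by apply: adapted_measurable_fun; exact: (adapted_comp (fun z => (h z)%:E) (chain_adapted n)).
Qed.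

Lemma chain_mean n (h : seq nat -> R) : (forall s, 0 <= h s) ->
  (\int[P]_w (h (chain Y n w).1.1)%:E = (mean_after n h [:: 0%N])%:E)%E.
Proof.
elim: n h => [|n IH] h h0; first exact: (integral_probability_cst P (h [:: 0%N])%:E).
rewrite (@chain_integral n (fun z => h z.1.1)) // mean_afterSr.
rewrite -IH; last by move=> s; rewrite divr_ge0 // addr_ge0 ?mulr_ge0.
apply: eq_integral => w _; move: (chain Y n w) => [[s e] v] /=.
rewrite (near_integral (@step_sigma_measurable n.+1 isT) (@step_sigma_indep n.+1 isT)
  (@toward_step_adapted n.+1 e) (@toward_fair n.+1 e isT) (c := gap (top s)) isT
  (f := fun b => h (new_stack s b))) //.
by congr _%:E; rewrite /mean_step /= addrC.
Qed.

(** The martingale of the proof. *)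
Definition deviation (n : nat) (z : state) : R :=
  z.2%:R - alpha R * n%:R + cubic_pot R z.1.1.

Let C : R := 16 + 2 * (4 + 7 * alpha R) ^+ 2 + 2 * (6 + 7 * alpha R) ^+ 2.

(** Turning back changes the potential by [O(L)]. By the Poisson equation, going on
    changes it by [O(gap * L)], but this has probability [1 / (gap + 1)]. With the
    second moment of the exit time, everything is of order [L ^ 3]. *)
Lemma deviation_step n z : stack z.1.1 ->
  (\int[P]_w (deviation n.+1 (next_state Y n.+1 z w) ^+ 2)%:E <=
   (deviation n z ^+ 2 + C * cube R z.1.1)%:E)%E.
Proof.
case: z => [[s e] v] /= ss.
pose f b := cubic_pot R (new_stack s b) - cubic_pot R s - alpha R.
set c := gap (top s).
have c1 : c.+1%:R != 0 :> R by rewrite pnatr_eq0.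
have fc : (c%:R * f true + f false) / c.+1%:R = - c%:R.
  have := mean_step_cubic R ss; rewrite /mean_step -/c /f /=.
  move: (cubic_pot R (advance s)) (cubic_pot R (retreat s)) (cubic_pot R s) => x y z E.
  have -> : x = (z - (c%:R - alpha R)) * c.+1%:R - c%:R * y.
    by rewrite -E divfK //; ring.
  by move: c1; rewrite -natr1 => c1; field.
have -> : (fun w => (deviation n.+1 (next_state Y n.+1 (s, e, v) w) ^+ 2)%:E) =
  (fun w => ((deviation n (s, e, v) +
     ((settle_time Y s e n.+1 w)%:R + f (settle_near Y s e n.+1 w))) ^+ 2)%:E).
  apply/funext => w; rewrite /deviation /next_state /= /f natrD -natr1.
  by congr (_ ^+ 2)%:E; ring.
have := ruin_shifted_square (@step_sigma_measurable n.+1 isT) (@step_sigma_indep n.+1 isT)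
  (@toward_step_adapted n.+1 e) (@toward_fair n.+1 e isT) (c := c) isT (deviation n (s, e, v)) fc.
move=> /le_trans; apply; rewrite lee_fin lerD2l /cube.
have a0 := alpha_gt0 R; set l : R := (extent s).+1%:R.
have cl : c%:R <= l.
  by rewrite ler_nat (leq_trans (gap_le _)) // ltnS stack_top_le.
have l1 : 1 <= l by rewrite ler1n.
have c0 : 1 <= c%:R :> R by rewrite ler1n.
have ft : `|f true| <= (4 + 7 * alpha R) * l.
  rewrite /f; apply: (le_trans (ler_normB _ _)).
  have := cubic_retreat_bound R ss; rewrite (gtr0_norm a0) -/l.
  have : alpha R <= alpha R * l by rewrite ler_peMr // ltW.
  by rewrite /new_stack; lra.
have ff : `|f false| <= c%:R * ((6 + 7 * alpha R) * l).
  have -> : f false = - (c%:R * (c%:R + 1 + f true)).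
    have : (c%:R * f true + f false) = - c%:R * c.+1%:R by rewrite -fc divfK.
    by rewrite -[c.+1%:R]natr1 => E; rewrite -[LHS](addKr (c%:R * f true)) E; ring.
  rewrite normrN normrM ger0_norm // ler_wpM2l //.
  apply: (le_trans (ler_normD _ _)); rewrite ger0_norm ?addr_ge0 //.
  by move: ft; lra.
have sq (x y : R) : `|x| <= y -> x ^+ 2 <= y ^+ 2.
  by move=> xy; rewrite -real_normK ?num_real // ler_pXn2r // nnegrE ?(le_trans _ xy).
have h1 : (c%:R * f true ^+ 2 + f false ^+ 2) / c.+1%:R <=
    ((4 + 7 * alpha R) * l) ^+ 2 + c%:R * ((6 + 7 * alpha R) * l) ^+ 2.
  rewrite ler_pdivrMr ?ltr0n // -[c.+1%:R]natr1.
  have := sq _ _ ft; have := sq _ _ ff; rewrite exprMn.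
  move: (f true ^+ 2) (f false ^+ 2) (sqr_ge0 ((4 + 7 * alpha R) * l))
    (sqr_ge0 ((6 + 7 * alpha R) * l)).
  move: (((4 + 7 * alpha R) * l) ^+ 2) (((6 + 7 * alpha R) * l) ^+ 2) c0.
  move: (c%:R : R) => x A B x1 F1 F2 A0 B0 h2 h1.
  have : x * F1 <= x * A by rewrite ler_wpM2l // (le_trans _ x1).
  have : 0 <= x * B by rewrite mulr_ge0 // (le_trans _ x1).
  by move: h2 A0; rewrite expr2; lra.
have h2 : c.+1%:R ^+ 2 * c%:R <= 4 * l ^+ 3.
  have : c.+1%:R <= 2 * l by rewrite -[c.+1%:R]natr1; lra.
  move=> c2; have -> : 4 * l ^+ 3 = (2 * l) ^+ 2 * l by ring.
  by rewrite ler_pM // ?ler_pXn2r ?nnegrE // ?exprn_ge0 // mulr_ge0 // (le_trans _ l1).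
have h3 : c%:R * ((6 + 7 * alpha R) * l) ^+ 2 <= (6 + 7 * alpha R) ^+ 2 * l ^+ 3.
  have -> : (6 + 7 * alpha R) ^+ 2 * l ^+ 3 = l * ((6 + 7 * alpha R) * l) ^+ 2 by ring.
  by rewrite ler_wpM2r // sqr_ge0.
have h4 : ((4 + 7 * alpha R) * l) ^+ 2 <= (4 + 7 * alpha R) ^+ 2 * l ^+ 3.
  by rewrite exprMn ler_wpM2l ?sqr_ge0 // ler_weXn2l.
apply: (@le_trans _ _ (2 * (2 * (4 * l ^+ 3) +
   ((4 + 7 * alpha R) ^+ 2 * l ^+ 3 + (6 + 7 * alpha R) ^+ 2 * l ^+ 3)))).
  rewrite ler_wpM2l // lerD ?ler_wpM2l //.
  by apply: (le_trans h1); rewrite lerD.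
by rewrite le_eqVlt; apply/orP; left; apply/eqP; rewrite /C; ring.
Qed.

Lemma deviation_square n :
  (\int[P]_w (deviation n (chain Y n w) ^+ 2)%:E <=
   (C * \sum_(0 <= i < n) mean_after i (cube R) [:: 0%N])%:E)%E.
Proof.
elim: n => [|n IH].
  rewrite big_geq // mulr0.
  have -> : (fun w => (deviation 0 (chain Y 0 w) ^+ 2)%:E) = cst (0 : \bar R).
    apply/funext => w; rewrite /deviation /chain /cubic_pot /=.
    by congr _%:E; ring.
  by rewrite integral_probability_cst.
rewrite (@chain_integral n (fun z => deviation n.+1 z ^+ 2)); last first.
  by move=> z; exact: sqr_ge0.
have C0 : 0 <= C.
  by rewrite /C !addr_ge0 // mulr_ge0 // sqr_ge0.
have cube0 s : 0 <= cube R s by rewrite /cube exprn_ge0.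
have md := @measurable_chain n (fun z => deviation n z ^+ 2).
have mc := @measurable_chain n (fun z => cube R z.1.1).
apply: (@le_trans _ _ (\int[P]_w ((deviation n (chain Y n w) ^+ 2)%:E +
    C%:E * (cube R (chain Y n w).1.1)%:E))%E).
  apply: ge0_le_integral => //.
  - by move=> w _; apply: integral_ge0 => w' _; rewrite lee_fin sqr_ge0.
  - apply: adapted_measurable_fun.
    exact: (adapted_comp (fun z => \int[P]_w' (deviation n.+1 (next_state Y n.+1 z w') ^+ 2)%:E)%E
      (chain_adapted n)).
  - by apply: emeasurable_funD => //; exact: measurable_funeM.
  - by move=> w _; rewrite -EFinM -EFinD; apply: deviation_step; exact: stack_chain.
rewrite ge0_integralD //; last 3 first.
- by move=> w _; rewrite lee_fin sqr_ge0.
- by move=> w _; rewrite mule_ge0 ?lee_fin.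
- exact: measurable_funeM.
rewrite ge0_integralZl ?lee_fin //.
  rewrite chain_mean // big_nat_recr //=; apply: (le_trans (leeD2r _ IH)).
  by rewrite -EFinM -EFinD -mulrDr.
by move=> w _; rewrite lee_fin.
Qed.

End ChainLaw.

(** * Erosion in terms of the chain *)

Definition first_hit (A : pred nat) : option nat :=
  if pselect (exists i, A i) is left ex then Some (ex_minn ex) else None.

Definition eligible (n : nat) (X : config) (y : nat -> int) (i : nat) : bool :=
  (0 < i)%N &&
  `[< exists2 s : site, y i = val s & X s = Uncolored \/ X s = opponent_color n >].

Lemma first_hitP (A : pred nat) t : A t -> (forall i, (i < t)%N -> ~~ A i) ->
  first_hit A = Some t.
Proof.
move=> At tmin; rewrite /first_hit; case: pselect => [ex|[]]; last by exists t.
case: ex_minnP => m Am mmin; congr Some; apply/eqP; rewrite eqn_leq mmin //=.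
by rewrite leqNgt; apply/negP => /tmin; rewrite Am.
Qed.

Section Settling.
Variable R : realType.

Definition time_ereal (o : option nat) : \bar R :=
  if o is Some i then (i%:R)%:E else +oo%E.

Lemma settling_timeE n X y :
  settling_time R n X y = time_ereal (first_hit (eligible n X y)).
Proof.
rewrite /settling_time /first_hit; case: pselect => [ex|nex] /=.
  case: ex_minnP => m /andP[m0 /asboolP mX] mmin.
  apply/eqP; rewrite eq_le; apply/andP; split.
    by apply: ereal_inf_lbound; exists m.
  apply: le_ereal_inf_tmp => _ [i [i0 iX] <-].
  by rewrite lee_fin ler_nat mmin // /eligible i0; apply/asboolP.
rewrite (_ : [set _ | _ in _] = set0) ?ereal_inf0 //.
apply/seteqP; split => // x [i [i0 iX] _]; apply: nex; exists i.
by rewrite /eligible i0; apply/asboolP.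
Qed.

Lemma settleE n X y (s : site) : settle R n X y s =
  if first_hit (eligible n X y) is Some i then
    (if y i == val s then particle_color n else X s) else X s.
Proof.
rewrite /settle settling_timeE; case: first_hit => [i|] /=; last first.
  by case: asboolP => // -[i].
case: eqP => [yi|yi]; case: asboolP => //.
  by case; exists i.
by move=> [j [/eqP]]; rewrite eqr_nat => /eqP <-.
Qed.

End Settling.

(** The configuration coded by the stack [s] when [e] is the near side; the
    innermost near run has the colour of the last particle, the innermost far run
    the other one. *)
Definition paint (n : nat) (s : seq nat) (e : bool) : config := fun x =>
  let near := (0 < val x) == e in
  match shade near s `|val x|%N with
  | Some b => if b == near then particle_color n else opponent_color n
  | None => Uncolored
  end.

Section OneParticle.
Variables (s : seq nat) (e : bool) (y : nat -> int).
Hypothesis ss : stack s.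
Hypothesis y0 : y 0 = 0.
Hypothesis y_step : forall i, y i.+1 - y i = 1 \/ y i.+1 - y i = -1.

Let b (i : nat) : bool := (y i.+1 - y i == 1) == e.
Let c : nat := gap (top s).
Let t : nat := ruin_time c b.
Let near : bool := ruin_near c b.

Hypothesis ruined : exists m, ~~ inside c (ruin c b m).

Lemma ruin_walk m : (forall i, (i < m)%N -> inside c (ruin c b i)) ->
  (ruin c b m)%:Z = c%:Z + (if e then y m else - y m).
Proof.
elim: m => [_|m IH ins]; first by rewrite y0; case: e; rewrite /= ?oppr0 addr0.
have im := ins m (ltnSn m); rewrite /= /ruin_step im.
have := IH (fun i im => ins i (ltnW im)); move: im => /andP[].
have -> : b m = ((y m.+1 - y m == 1) == e) by [].
move: (ruin c b m) (y_step m) => j.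
by case: e => -[] E; rewrite E /=; lia.
Qed.

Lemma ruin_time_gt0 : (0 < t)%N.
Proof.
have [m out] := ruined; have [+ _] := ruin_timeP out.
by rewrite lt0n; apply: contra => /eqP; rewrite /t => ->; rewrite /= /inside /c leqnn.
Qed.

Lemma final_position : y t =
  if near then (if e then 1 else -1) else (if e then - c%:Z else c%:Z).
Proof.
have [m out] := ruined; have [outt ins] := ruin_timeP out.
have E := ruin_walk ins; have := ruin_le c b t; move: E outt.
rewrite /near /ruin_near -/t /inside; move: (ruin c b t) (y t) => j z.
by case: (@eqP _ j c.+1) => [->|jc]; case: e => /= *; lia.
Qed.

Lemma shade_inner (x : nat) : (x < c)%N -> shade false s x = Some true.
Proof.
rewrite /c /gap; case: s ss => [//|z l] _ /=.
by rewrite ltnS => ->.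
Qed.

Lemma shade_outer : match shade false s c with None => True | Some a => a = false end.
Proof.
rewrite /c /gap; case: s ss => [//|z [|z' l]] st /=; rewrite ltnn //.
have : (z < z')%N by move: st; rewrite stack_cons2 => /and3P[].
case: ifP => // /negP h zz'; exfalso; apply: h.
rewrite /run_end uphalf_half; have := odd_double_half z; have := odd_double_half z'.
by case: (odd z); case: (odd z') => /=; lia.
Qed.

Lemma shade_first : match shade true s 1 with None => True | Some a => a = true end.
Proof.
case: s ss => [//|[|z] l] st /=; last by [].
by move: st; rewrite /stack /= => /orP[/eqP[->]|].
Qed.

Variable n : nat.

Lemma opponent_colorS : opponent_color n.+1 = particle_color n.
Proof. by rewrite /opponent_color /particle_color /=; case: odd. Qed.

Lemma particle_colorS : particle_color n.+1 = opponent_color n.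
Proof. by rewrite /opponent_color /particle_color /=; case: odd. Qed.

(** Before leaving the interval the walk visits the origin and sites of the
    innermost far run, which carry the colour of the moving particle. *)
Lemma eligible_first : first_hit (eligible n.+1 (paint n s e) y) = Some t.
Proof.
have [m out] := ruined; have [outt ins] := ruin_timeP out.
apply: first_hitP.
  rewrite /eligible ruin_time_gt0; apply/asboolP.
  have yt : y t != 0.
    by rewrite final_position /c /gap; case: near; case: e => //; lia.
  exists (exist _ (y t) yt) => //.
  rewrite opponent_colorS /paint /= final_position.
  case: near.
    have -> : (0 < (if e then 1 else -1 : int)) == e by case: e.
    have -> : absz (if e then 1 else -1) = 1%N by case: e.
    by have := shade_first; case: (shade true s 1) => [a ->|_]; [right|left].
  have -> : ((0 < (if e then - c%:Z else c%:Z)) == e) = false.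
    by rewrite /c /gap; case: e; lia.
  have -> : absz (if e then - c%:Z else c%:Z) = c by case: e; lia.
  by have := shade_outer; case: (shade false s c) => [a ->|_]; [right|left].
move=> i it; rewrite /eligible; apply/negP => /andP[i0 /asboolP[[x x0]]] /= yx.
have := ruin_walk (fun j (ji : (j < i)%N) => ins j (ltn_trans ji it)).
have := ins i it; rewrite /inside => /andP[j1 jc] E.
have xc : (`|x| < c)%N by move: x0 E; rewrite yx; case: e; lia.
rewrite opponent_colorS /paint /=.
have -> : ((0 < x) == e) = false.
  by move: x0 E; rewrite yx; case: e; case: ltrP; lia.
rewrite shade_inner //=.
by rewrite /opponent_color /particle_color; case: odd => -[].
Qed.

Lemma settle_paint (R : realType) :
  settle R n.+1 (paint n s e) y = paint n.+1 (new_stack s near) (near == e).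
Proof.
apply/funext => -[x x0]; rewrite settleE eligible_first /= final_position.
rewrite /paint /= opponent_colorS particle_colorS.
have x1 : (0 < `|x|)%N by lia.
rewrite /new_stack; case: near => /=.
  rewrite shade_retreat //.
  have -> : (true == e) = e by case: e.
  have -> : ((if e then 1 else -1 : int) == x) = ((0 < x) == e) && (`|x|%N == 1%N).
    by case: e; lia.
  case: ((0 < x) == e) => /=; first by case: eqP => // _; case: shade => [[]|].
  by case: shade => [[]|].
have -> : (false == e) = ~~ e by case: e.
have -> : ((if e then - c%:Z else c%:Z) == x) = ((0 < x) != e) && (`|x|%N == c).
  by rewrite /c /gap; case: e => /=; lia.
have -> : ((0 < x) == ~~ e) = ((0 < x) != e) by case: e; case: (0 < x).
case: ((0 < x) == e) => /=.
  by rewrite shade_advance_far //; case: shade => [[]|].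
rewrite shade_advance_near // -/c; case: eqP => //= _.
by case: shade => [[]|].
Qed.

End OneParticle.

Section Link.
Variables (T : Type) (Y : nat -> nat -> T -> int) (R : realType) (w : T).

(** Holds almost surely; on such outcomes erosion is a function of the chain. *)
Definition regular (n : nat) : Prop :=
  [/\ Y n 0 w = 0,
      forall i, Y n i.+1 w - Y n i w = 1 \/ Y n i.+1 w - Y n i w = -1 &
      forall c e, (0 < c)%N ->
        exists m, ~~ inside c (ruin c (fun i => toward Y e n i w) m)].

Hypothesis Yw : forall n, (1 <= n)%N -> regular n.

Let Yn (n i : nat) : int := Y n i w.

Lemma erosion_chain n : erosion R Yn n = paint n (chain Y n w).1.1 (chain Y n w).1.2.
Proof.
elim: n => [|n IH].
  apply/funext => -[x x0]; rewrite /paint /=.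
  have -> : (absz x <= run_end ((0 < x)%R == true) 0)%N = false.
    by rewrite /run_end; case: ifP => _; lia.
  by [].
have [Y0 Yst Yr] := Yw (ltn0Sn n).
rewrite /= IH; have ss := stack_chain Y n w.
move: (chain Y n w) ss => [[s e] v] /= ss.
exact: (@settle_paint s e (Yn n.+1) ss Y0 Yst (Yr (gap (top s)) e isT) n R).
Qed.

Lemma tau_chain n : tau R Yn n.+1 =
  ((settle_time Y (chain Y n w).1.1 (chain Y n w).1.2 n.+1 w)%:R)%:E.
Proof.
have [Y0 Yst Yr] := Yw (ltn0Sn n).
rewrite /tau settling_timeE erosion_chain /=; have ss := stack_chain Y n w.
move: (chain Y n w) ss => [[s e] v] /= ss.
by rewrite (@eligible_first s e (Yn n.+1) ss Y0 Yst (Yr (gap (top s)) e isT)).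
Qed.

Lemma total_steps_chain n : total_steps R Yn n = ((chain Y n w).2%:R)%:E.
Proof.
elim: n => [|n IH]; first by rewrite /total_steps big_geq.
rewrite /total_steps big_nat_recr //= -/(total_steps R Yn n) IH tau_chain.
by rewrite -EFinD -natrD.
Qed.

End Link.

Section Measurability.
Variables (T : Type) (G : set (set T)) (R : realType) (Y : nat -> nat -> T -> int).
Hypothesis GS : sigma_algebra setT G.
Hypothesis GY : forall n i, (1 <= n)%N -> adapted G (Y n i).

Lemma first_hit_adapted (A : T -> pred nat) :
  (forall i, G [set w | A w i]) -> adapted G (fun w => first_hit (A w)).
Proof.
move=> GA; apply: adapted_fibers => // -[i|].
  rewrite (_ : _ @^-1` _ = [set w | A w i] `&`
      \bigcap_j [set w | ~~ ((j < i)%N && A w j)]).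
    apply: sigma_setI => //; apply: sigma_bigcap => // j.
    case: (j < i)%N => /=; last by rewrite (_ : [set w | _] = setT); [exact: sigma_setT|apply/seteqP; split].
    rewrite (_ : [set w | _] = ~` [set w | A w j]); first exact: sigma_setC.
    by apply/seteqP; split => w /=; [move/negP|move=> h; apply/negP].
  apply/seteqP; split => w /=.
    rewrite /first_hit; case: pselect => // ex; case: ex_minnP => m Am mmin [<-].
    split => // j _ /=; apply/negP => /andP[jm /mmin].
    by rewrite leqNgt jm.
  move=> [Ai Aj]; apply: first_hitP => // j ji.
  by have := Aj j I; rewrite /= ji.
rewrite (_ : _ @^-1` _ = ~` \bigcup_j [set w | A w j]).
  by apply: sigma_setC => //; exact: sigma_bigcup.
apply/seteqP; split => w /=.
  rewrite /first_hit; case: pselect => // nex _ [j _ Aj].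
  by apply: nex; exists j.
move=> nA; rewrite /first_hit; case: pselect => // -[j Aj].
by exfalso; apply: nA; exists j.
Qed.

Lemma eligible_adapted n (X : T -> config) (y : nat -> T -> int) i :
  (forall s, adapted G (fun w => X w s)) -> (forall i, adapted G (y i)) ->
  G [set w | eligible n (X w) (y^~ w) i].
Proof.
move=> GX Gy; rewrite /eligible; case: i => [|i] /=.
  by rewrite (_ : [set w | _] = set0); [case: GS|apply/seteqP; split].
rewrite (_ : [set w | _] = \bigcup_(s : site) ([set w | y i.+1 w = val s] `&`
    [set w | X w s = Uncolored \/ X w s = opponent_color n])).
  apply: sigma_bigcup => // s; apply: sigma_setI => //.
    exact: (Gy i.+1 [set z | z = val s]).
  exact: (GX s [set x | x = Uncolored \/ x = opponent_color n]).
apply/seteqP; split => w /=.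
  by move=> /asboolP[s ys Xs]; exists s.
by move=> [s _ [ys Xs]]; apply/asboolP; exists s.
Qed.

Lemma erosion_adapted n s : adapted G (fun w => erosion R (fun m i => Y m i w) n s).
Proof.
elim: n s => [|n IH] s; first exact: adapted_cst.
have Gf : adapted G (fun w =>
    first_hit (eligible n.+1 (erosion R (fun m i => Y m i w) n) (fun i => Y n.+1 i w))).
  apply: first_hit_adapted => i.
  by apply: (eligible_adapted _ (y := Y n.+1)) => // j; exact: GY.
pose f (o : option nat) w := if o is Some i then
  (if Y n.+1 i w == val s then particle_color n.+1
   else erosion R (fun m i => Y m i w) n s)
  else erosion R (fun m i => Y m i w) n s.
rewrite (_ : (fun w => _) = (fun w => f (first_hit (eligible n.+1
    (erosion R (fun m i => Y m i w) n) (fun i => Y n.+1 i w))) w)).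
  apply: (@adapted_bind _ _ GS _ _ _ f) => // -[i|]; last exact: IH.
  apply: (@adapted_bind _ _ GS _ _ (Y n.+1 i) (fun z w => if z == val s
     then particle_color n.+1 else erosion R (fun m i => Y m i w) n s)).
    exact: GY.
  by move=> z; case: eqP => _; [exact: adapted_cst|exact: IH].
by apply/funext => w; rewrite /= settleE.
Qed.

(** The total is a function of a variable with countably many values, infinity
    being one of them. *)
Lemma total_steps_adapted n : adapted G (fun w => total_steps R (fun m i => Y m i w) n).
Proof.
suff [V [GV VE]] : exists V : T -> option nat, adapted G V /\
    forall w, total_steps R (fun m i => Y m i w) n = time_ereal R (V w).
  rewrite (_ : (fun w => _) = time_ereal R \o V); first exact: adapted_comp.
  exact/funext.
elim: n => [|n [V [GV VE]]].
  exists (fun=> Some 0%N); split; first exact: adapted_cst.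
  by move=> w; rewrite /total_steps big_geq.
pose H w := first_hit (eligible n.+1 (erosion R (fun m i => Y m i w) n)
  (fun i => Y n.+1 i w)).
have GH : adapted G H.
  apply: first_hit_adapted => i; apply: (eligible_adapted _ (y := Y n.+1)).
    exact: erosion_adapted.
  by move=> j; exact: GY.
pose f (o : option nat) w := if o is Some a then omap (addn a) (H w) else None.
exists (fun w => f (V w) w); split.
  apply: (@adapted_bind _ _ GS _ _ _ f) => // -[a|]; last exact: adapted_cst.
  exact: adapted_comp.
move=> w; rewrite /total_steps big_nat_recr //= -/(total_steps _ _ n) VE.
rewrite /f /tau settling_timeE -/(H w); case: (V w) => [a|]; case: (H w) => [c|] //=.
by rewrite natrD EFinD.
Qed.

End Measurability.

(** * Convergence *)

Section Convergence.
Context d (T : measurableType d) (R : realType) (P : probability T R).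
Variable Y : nat -> nat -> T -> int.
Hypothesis Y_walk : forall n, (1 <= n)%N -> simple_symmetric_random_walk P (Y n).
Hypothesis Y_indep : mutually_independent P [set n : nat | (1 <= n)%N]
                       (fun n => sigma_process (Y n)).

Let measY n i : (1 <= n)%N -> adapted measurable (Y n i).
Proof. by move=> n1 B; apply: (inputs_measurable Y_walk (n := n)); split; last exact: position_adapted. Qed.

Lemma unit_steps_ae n i : (1 <= n)%N -> P.-negligible
  [set w | ~ (Y n i.+1 w - Y n i w = 1 \/ Y n i.+1 w - Y n i w = -1)].
Proof.
move=> n1; have [_ _ _ /(_ i)[Pu Pd]] := Y_walk n1.
have ms := step_adapted i (sigma_algebra_measurable T) (fun j => measY j n1).
pose up := [set w | Y n i.+1 w - Y n i w = 1].
pose down := [set w | Y n i.+1 w - Y n i w = -1].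
have mu : measurable up by exact: (ms [set 1]).
have md : measurable down by exact: (ms [set -1]).
exists (~` (up `|` down)); split => //.
  by apply: measurableC; exact: measurableU.
have PU : P (up `|` down) = (P up + P down)%E.
  apply: measureU => //; apply/seteqP; split => // w [E1 E2].
  by move: E2; rewrite /down /= E1.
rewrite probability_setC; last exact: measurableU.
have half2 : 2^-1 + 2^-1 = 1 :> R by field.
by rewrite PU Pu Pd -EFinD half2 subrr.
Qed.

Lemma never_ruined_ae n c e : (1 <= n)%N -> (0 < c)%N -> P.-negligible
  [set w | forall m, inside c (ruin c (fun i => toward Y e n i w) m)].
Proof.
move=> n1 c0.
have Fm := step_sigma_measurable Y_walk n1.
have Fi := step_sigma_indep Y_walk n1.
have Fb := toward_step_adapted Y n e.
have Ff := toward_fair Y_walk e n1.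
exists [set w | forall m, inside c (ruin c (fun i => toward Y e n i w) m)]; split => //.
- exact: (never_measurable c Fm Fi Fb).
- exact: (never_ruined Fm Fi Fb Ff c0).
Qed.

Lemma irregular_negligible : P.-negligible
  [set w | ~ (forall n, (1 <= n)%N -> regular Y w n)].
Proof.
pose jump n i := [set w | ~ (Y n i.+1 w - Y n i w = 1 \/ Y n i.+1 w - Y n i w = -1)].
pose never e n c :=
  [set w | forall m, inside c (ruin c (fun i => toward Y e n i w) m)].
apply: (@negligibleS _ _ _ P (\bigcup_n ((\bigcup_i jump n.+1 i) `|`
    (\bigcup_c (never true n.+1 c.+1 `|` never false n.+1 c.+1))))).
  move=> w /=; apply: contra_notP => h [|n] // _; split.
  - by have [_ -> _ _] := Y_walk (ltn0Sn n).
  - move=> i; apply: contrapT => hi; apply: h; exists n => //; left; by exists i.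
  - move=> [//|c] e _; apply: contrapT => hc; apply: h; exists n => //; right; exists c => //.
    have all m : inside c.+1 (ruin c.+1 (fun i => toward Y e n.+1 i w) m).
      by apply: contraPT hc => out; apply; exists m.
    by case: e {hc} all => all; [left|right].
apply: negligible_bigcup => n; apply: negligibleU; apply: negligible_bigcup => i.
  exact: unit_steps_ae.
by apply: negligibleU; exact: never_ruined_ae.
Qed.

Let cube_int n : (\int[P]_w (cube R (chain Y n w).1.1)%:E =
  (mean_after n (cube R) [:: 0%N])%:E)%E.
Proof. by apply: chain_mean => // s; rewrite /cube exprn_ge0. Qed.

Let C : R := 16 + 2 * (4 + 7 * alpha R) ^+ 2 + 2 * (6 + 7 * alpha R) ^+ 2.
Let K : R := 10 + 8 * alpha R.

(** Chebyshev's inequality for the martingale part and Markov's inequality for the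
    potential, in a single nonnegative test function. *)
Lemma deviation_prob (e : R) n : 0 < e -> (0 < n)%N ->
  (P [set w | (e%:E < `|total_steps R (fun m i => Y m i w) n * (n%:R^-1)%:E
                 - (alpha R)%:E|)%E] <=
   (4 / (e * n%:R) ^+ 2 * (C * \sum_(0 <= i < n) mean_after i (cube R) [:: 0%N]) +
    2 * K / (e * n%:R) * mean_after n (cube R) [:: 0%N])%:E)%E.
Proof.
move=> e0 n0; have n0' : 0 < n%:R :> R by rewrite ltr0n.
have a0 := alpha_gt0 R.
have en0 : 0 < e * n%:R by rewrite mulr_gt0.
set B := [set w | _].
pose B' := [set w | e * n%:R < `|(chain Y n w).2%:R - alpha R * n%:R|].
have mB : measurable B.
  pose far (x : \bar R) := (e%:E < `|x * (n%:R^-1)%:E - (alpha R)%:E|)%E.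
  have := @total_steps_adapted T _ R Y (sigma_algebra_measurable T) measY n.
  by move=> /(_ [set x | far x]).
have mB' : measurable B'.
  exact: (chain_adapted Y_walk Y_indep n
    [set z : state | e * n%:R < `|z.2%:R - alpha R * n%:R|]).
have [N [mN PN irr]] := irregular_negligible.
have BB' : (P B <= P B')%E.
  rewrite -[leRHS]adde0 -PN; have := measureU2 P mB' mN; apply: le_trans.
  apply: le_measure; rewrite ?inE //; first exact: measurableU.
  move=> w Bw; have [reg|] := pselect (forall n, (1 <= n)%N -> regular Y w n).
    left; move: Bw; rewrite /B /B' /= (total_steps_chain R reg).
    rewrite -EFinM -EFinB /= lte_fin => h.
    have -> : (chain Y n w).2%:R - alpha R * n%:R =
       ((chain Y n w).2%:R * n%:R^-1 - alpha R) * n%:R.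
      by rewrite mulrBl mulfVK // gt_eqF.
    by rewrite normrM (gtr0_norm n0') ltr_pM2r.
  by move=> nreg; right; exact: irr.
apply: (le_trans BB'); rewrite -(integral_probability_indic P mB').
pose a : R := 4 / (e * n%:R) ^+ 2; pose b : R := 2 * K / (e * n%:R).
have a_ge0 : 0 <= a by rewrite divr_ge0 ?sqr_ge0.
have K0 : 0 <= K by rewrite addr_ge0 ?mulr_ge0 // ltW.
have b_ge0 : 0 <= b by rewrite divr_ge0 ?mulr_ge0 // ltW.
have cube0 s : 0 <= cube R s by rewrite /cube exprn_ge0.
have md := measurable_chain Y_walk Y_indep n (fun z => deviation R n z ^+ 2).
have mc := measurable_chain Y_walk Y_indep n (fun z => cube R z.1.1).
apply: (@le_trans _ _ (\int[P]_w (a%:E * (deviation R n (chain Y n w) ^+ 2)%:E +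
    b%:E * (cube R (chain Y n w).1.1)%:E))%E).
  apply: ge0_le_integral => //.
  - by apply/measurable_EFinP; exact: measurable_indic.
  - by apply: emeasurable_funD; exact: measurable_funeM.
  move=> w _; rewrite -!EFinM -EFinD lee_fin indicE mem_bool_set.
  set x := deviation R n _; set y := cube R _.
  have y0 : 0 <= y by exact: cube0.
  have ab0 : 0 <= a * x ^+ 2 + b * y by rewrite addr_ge0 // mulr_ge0 // sqr_ge0.
  case: (boolP (e * n%:R < _)) => [big|_] /=; last by [].
  have gy : `|cubic_pot R (chain Y n w).1.1| <= K * y.
    exact: cubic_bound (stack_chain Y n w).
  have xy : e * n%:R <= `|x| + K * y.
    apply: (le_trans (ltW big)); apply: le_trans (lerD (lexx _) gy).
    have -> : (chain Y n w).2%:R - alpha R * n%:R =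
      x - cubic_pot R (chain Y n w).1.1 by rewrite /x /deviation; ring.
    exact: ler_normB.
  have [xl|xs] := leP (e * n%:R) (2 * `|x|).
    apply: (@le_trans _ _ (a * x ^+ 2)); last by rewrite lerDl mulr_ge0.
    rewrite /a mulrAC ler_pdivlMr ?exprn_gt0 // mul1r -(real_normK (num_real x)).
    have -> : 4 * `|x| ^+ 2 = (2 * `|x|) ^+ 2 by ring.
    by rewrite ler_pXn2r // nnegrE ?mulr_ge0 // ltW.
  apply: (@le_trans _ _ (b * y)); last by rewrite lerDr mulr_ge0 ?sqr_ge0.
  rewrite /b mulrAC ler_pdivlMr // mul1r.
  by move: xy xs; lra.
rewrite ge0_integralD //; last 4 first.
- by move=> w _; rewrite mule_ge0 ?lee_fin ?sqr_ge0.
- exact: measurable_funeM.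
- by move=> w _; rewrite mule_ge0 ?lee_fin.
- exact: measurable_funeM.
rewrite !ge0_integralZl ?lee_fin //.
- rewrite cube_int EFinD; apply: leeD; last by rewrite -EFinM.
  rewrite [X in (_ <= X)%E]EFinM; apply: lee_wpmul2l; first by rewrite lee_fin.
  exact: deviation_square.
- by move=> w _; rewrite lee_fin.
- by move=> w _; rewrite lee_fin sqr_ge0.
Qed.

Lemma total_steps_cvg :
  cvg_in_probability P (fun n w =>
    (total_steps R (fun m i => Y m i w) n * (n%:R^-1)%:E)%E) (alpha R).
Proof.
move=> e e0; have a0 := alpha_gt0 R.
have [A [B [A0 B0 HAB]]] := cube_growth R.
have C0 : 0 < C.
  rewrite /C; have := sqr_ge0 (4 + 7 * alpha R); have := sqr_ge0 (6 + 7 * alpha R).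
  by move: (_ ^+ 2) (_ ^+ 2) => x y x0 y0; lra.
have K0 : 0 < K by rewrite addr_gt0 // mulr_gt0.
pose D := 4 * C / e ^+ 2 + 2 * K / e.
have D0 : 0 < D by rewrite addr_gt0 // divr_gt0 ?mulr_gt0 ?exprn_gt0.
have bound (t : R) n : 0 < t -> (0 < n)%N ->
    (P [set w | (e%:E < `|total_steps R (fun m i => Y m i w) n * (n%:R^-1)%:E
                 - (alpha R)%:E|)%E] <=
    (D * (t * (A + B)) + D * t^-1 ^+ 3 / n%:R)%:E)%E.
  move=> t0 n0; apply: (le_trans (deviation_prob e0 n0)); rewrite lee_fin.
  have n0' : 0 < n%:R :> R by rewrite ltr0n.
  have n1 : 1 <= n%:R :> R by rewrite ler1n.
  pose M := t * (A * n%:R + B) + t^-1 ^+ 3.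
  have mM i : (i <= n)%N -> mean_after i (cube R) [:: 0%N] <= M.
    move=> le_in; apply: (le_trans (HAB t i t0)); rewrite lerD2r ler_wpM2l ?(ltW t0) //.
    by rewrite lerD2r ler_wpM2l // ler_nat.
  have sM : \sum_(0 <= i < n) mean_after i (cube R) [:: 0%N] <= n%:R * M.
    have -> : n%:R * M = \sum_(0 <= i < n) M.
      by rewrite sumr_const_nat subn0 mulr_natl.
    rewrite big_nat [leRHS]big_nat; apply: ler_sum => i /andP[_ /ltnW]; exact: mM.
  have en0 : 0 < e * n%:R by rewrite mulr_gt0.
  apply: (@le_trans _ _ (4 / (e * n%:R) ^+ 2 * (C * (n%:R * M)) + 2 * K / (e * n%:R) * M)).
    rewrite lerD // ler_wpM2l ?mM // ?divr_ge0 ?mulr_ge0 ?sqr_ge0 // ?ler_wpM2l ?(ltW C0) ?(ltW K0) ?(ltW e0) //.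
  have -> : 4 / (e * n%:R) ^+ 2 * (C * (n%:R * M)) + 2 * K / (e * n%:R) * M = D * (M / n%:R).
    by rewrite /D; field; rewrite !gt_eqF.
  have -> : D * (t * (A + B)) + D * t^-1 ^+ 3 / n%:R =
     D * (t * (A + B) + t^-1 ^+ 3 / n%:R) by ring.
  rewrite ler_wpM2l ?(ltW D0) // /M mulrDl lerD2r -mulrA ler_wpM2l ?(ltW t0) //.
  rewrite mulrDl mulfK ?gt_eqF // lerD2l ler_pdivrMr // ler_peMr //.
have fin n : P [set w | (e%:E < `|total_steps R (fun m i => Y m i w) n * (n%:R^-1)%:E
                 - (alpha R)%:E|)%E] \is a fin_num.
  apply: fin_num_measure.
  pose far (x : \bar R) := (e%:E < `|x * (n%:R^-1)%:E - (alpha R)%:E|)%E.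
  have := @total_steps_adapted T _ R Y (sigma_algebra_measurable T) measY n.
  by move=> /(_ [set x | far x]).
apply/fine_cvgP; split; first exact: nearW.
apply/cvgrPdist_le => h h0.
pose t := h / (2 * D * (A + B + 1)).
have AB1 : 0 < A + B + 1 by rewrite ltr_wpDl ?addr_ge0.
have t0 : 0 < t by rewrite divr_gt0 // !mulr_gt0.
have [N HN] := archimedean_div_lt (2 * (D * t^-1 ^+ 3)) h0.
near=> n.
have nN : (N.+1 <= n)%N by near: n; exists N.+1.
have n0 : (0 < n)%N by exact: leq_ltn_trans nN.
rewrite sub0r normrN ger0_norm ?fine_ge0 //.
rewrite -lee_fin fineK //; apply: (le_trans (bound t n t0 n0)); rewrite lee_fin.
have h1 : D * (t * (A + B)) <= h / 2.
  apply: (@le_trans _ _ (D * (t * (A + B + 1)))).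
    by rewrite ler_wpM2l ?(ltW D0) // ler_wpM2l ?(ltW t0) // lerDl.
  by rewrite le_eqVlt; apply/orP; left; apply/eqP; rewrite /t; field; rewrite !gt_eqF.
have h2 : D * t^-1 ^+ 3 / n%:R <= h / 2.
  apply: (@le_trans _ _ (D * t^-1 ^+ 3 / N.+1%:R)).
    rewrite ler_wpM2l ?mulr_ge0 ?(ltW D0) ?exprn_ge0 ?invr_ge0 ?(ltW t0) //.
    by rewrite lef_pV2 ?posrE ?ltr0n // ler_nat.
  by move: HN; rewrite -mulrA; move: (D * _ / _) => z; lra.
by move: h1 h2; move: (D * (t * _)) (D * _ / _) => x z; lra.
Unshelve. all: by end_near.
Qed.

End Convergence.

Theorem theorem2p3 (d : measure_display) (T : measurableType d) (R : realType)
    (P : probability T R) (Y : nat -> nat -> T -> int)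
    (Y_walk : forall n, (1 <= n)%N -> simple_symmetric_random_walk P (Y n))
    (Y_indep : mutually_independent P [set n : nat | (1 <= n)%N]
                 (fun n => sigma_process (Y n))) :
  let V (n : nat) (w : T) : \bar R := total_steps R (fun m i => Y m i w) n in
  cvg_in_probability P (fun n w => (V n w * (n%:R^-1)%:E)%E) (alpha R).
Proof. exact: total_steps_cvg. Qed.
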